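(* Let $0<r<R$, $W=B(0,R)\setminus B(0,r)\subset\mathbb{R}^2$, $\theta(x)=\arg(x)$ (that is, one spiral center, $N=1$, at $a_1=0$ with $m_1=1$), and $c(x)=c_0|x|$ for $x\in\overline W$, for some constant $c_0>0$. Assume further that $u_0(x)=g(x/|x|)$ for all $x\in\overline W$, for a given $g\in C^2(\mathbb{R}^2)$ with $\|Dg\|_{L^\infty}<1$. Let $u$ be the unique viscosity solution to $$\begin{cases} u_t =|D(u-\theta)| \left(\operatorname{div}\left(\frac{D(u-\theta)}{|D(u-\theta)|}\right)+c(x)\right) & \text{in } W\times(0,\infty), \\ D(u-\theta)\cdot \mathbf{n}=0 & \text{on } \partial W\times(0,\infty),\\ u(\cdot,0)=u_0 & \text{on } \overline W. \end{cases}$$ Then $$u(x,t)=g\Big(\mathcal{R}_{-c_0t}\frac{x}{|x|}\Big)+c_0t\qquad\text{for all }(x,t)\in\overline W\times[0,\infty).$$ In particular, $u(x,t)-c_0t$ does not converge as $t\to\infty$ if $g$ is not constant.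
   Context: $B(0,\rho)$ is the ball of radius $\rho$ centered at the origin. For an angle $\varphi$, $\mathcal{R}_\varphi=\begin{pmatrix}\cos\varphi&-\sin\varphi\\ \sin\varphi&\cos\varphi\end{pmatrix}$ is the counterclockwise rotation of $\mathbb{R}^2$ by $\varphi$. $\mathbf{n}$ is the outward unit normal to $\partial W$. The function $\theta=\arg$ is multi-valued, but $D\theta(x)=x^\perp/|x|^2$ with $(x_1,x_2)^\perp=(-x_2,x_1)$ is single-valued and smooth on $\overline W$; only $D\theta$ and $D^2\theta$ enter the equation, and $D(u-\theta)$ means $Du-D\theta$. Viscosity solutions are understood in the standard sense for level-set mean curvature type equations with Neumann boundary condition; it is known that this problem is well posed, with a unique viscosity solution $u\in C(\overline W\times[0,\infty))$.
   Formalization: ''If g is not constant'' is taken as ''g is not constant on the unit circle'': for g(x)=exp(-|x|^2)/2, which is nonconstant but constant on the circle, u(x,t)-c_0t is constant in t and converges. *)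

(* Defs.v *)
From HB Require Import structures.
From mathcomp Require Import all_boot all_order all_algebra.
From mathcomp Require Import all_classical all_reals all_analysis.

Set Implicit Arguments.
Unset Strict Implicit.
Unset Printing Implicit Defensive.
Import Order.TTheory GRing.Theory Num.Theory.
Import numFieldNormedType.Exports.

Local Open Scope classical_set_scope.
Local Open Scope ring_scope.

(** * The Euclidean plane ['cV[R]_2] *)

(** The norm [`|x|] and the balls that the library puts on ['cV[R]_2] are those
    of the max norm: they serve only for the topology and for derivatives.  All
    lengths below are Euclidean. *)

Definition dot (R : realType) (x y : 'cV[R]_2) : R := \sum_i x i 0 * y i 0.

Definition enorm (R : realType) (x : 'cV[R]_2) : R := Num.sqrt (dot x x).

Definition vec2 (R : realType) (a b : R) : 'cV[R]_2 :=
  \col_i (if i == 0 then a else b).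

Definition perp (R : realType) (x : 'cV[R]_2) : 'cV[R]_2 :=
  vec2 (- x 1 0) (x 0 0).

Definition rotation (R : realType) (phi : R) : 'M[R]_2 :=
  \matrix_(i, j) (if i == j then cos phi
                  else if i == 0 then - sin phi else sin phi).

Definition annulus (R : realType) (r1 r2 : R) : set 'cV[R]_2 :=
  [set x | r1 < enorm x < r2].

Definition boundary (T : topologicalType) (A : set T) : set T :=
  closure A `\` A°.

(** Outward unit normal of [annulus r1 r2]; only its values on the boundary
    circles are meaningful. *)
Definition annulus_normal (R : realType) (r1 r2 : R) (x : 'cV[R]_2) : 'cV[R]_2 :=
  if enorm x == r2 then (enorm x)^-1 *: x else - ((enorm x)^-1 *: x).

(** * Differential calculus *)

Definition basis2 (R : realType) (i : 'I_2) : 'cV[R]_2 := delta_mx i 0.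

Definition grad (R : realType) (f : 'cV[R]_2 -> R) (x : 'cV[R]_2) : 'cV[R]_2 :=
  \col_i 'D_(basis2 R i) f x.

Definition jacobian (R : realType) (F : 'cV[R]_2 -> 'cV[R]_2) (x : 'cV[R]_2)
    : 'M[R]_2 :=
  \matrix_(i, j) 'D_(basis2 R j) (fun y => F y i 0) x.

Definition hessian (R : realType) (f : 'cV[R]_2 -> R) (x : 'cV[R]_2) : 'M[R]_2 :=
  jacobian (grad f) x.

(** Classes C^1 and C^2 on an open subset of a finite-dimensional space. *)
Definition C1_on (R : realType) (V : normedModType R) (U : set V) (f : V -> R)
    : Prop :=
  (forall x, U x -> differentiable f x) /\
  (forall v x, U x -> {for x, continuous (fun y => 'D_v f y)}).

Definition C2_on (R : realType) (V : normedModType R) (U : set V) (f : V -> R)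
    : Prop :=
  C1_on U f /\ (forall v, C1_on U (fun y => 'D_v f y)).

(** The norm of [Dg] in L^infty(R^2), with the Euclidean norm on vectors and the
    Lebesgue measure of the plane. *)
Definition grad_Linfty (R : realType) (g : 'cV[R]_2 -> R) : \bar R :=
  ('N[lebesgue_measure \x lebesgue_measure]_+oo [
     (fun z : R * R => (enorm (grad g (vec2 z.1 z.2)))%:E) ])%E.

(** * The level-set equation and its viscosity solutions *)

(** [D theta] for [theta = arg]. *)
Definition Dtheta (R : realType) (x : 'cV[R]_2) : 'cV[R]_2 :=
  (enorm x ^+ 2)^-1 *: perp x.

(** For [D w = p <> 0] and [D^2 w = X],
    [|Dw| (div (Dw / |Dw|) + c) = tr ((I - p p^T / |p|^2) X) + c |p|]. *)
Definition levelset_op (R : realType) (c : 'cV[R]_2 -> R)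
    (z : 'cV[R]_2 * 'cV[R]_2 * 'M[R]_2) : R :=
  let: (x, p, X) := z in
  \tr ((1%:M - (enorm p ^+ 2)^-1 *: (p *m p^T)) *m X) + c x * enorm p.

(** The operator above is singular at [p = 0], so it enters the definition of
    viscosity solutions through the upper and lower semicontinuous envelopes of
    its restriction to this set. *)
Definition regular_arg (R : realType) (W : set 'cV[R]_2)
    : set ('cV[R]_2 * 'cV[R]_2 * 'M[R]_2) :=
  [set z | closure W z.1.1 /\ z.1.2 != 0].

Definition usc_op (R : realType) (W : set 'cV[R]_2) (c : 'cV[R]_2 -> R)
    (z : 'cV[R]_2 * 'cV[R]_2 * 'M[R]_2) : \bar R :=
  limf_esup (fun y => (levelset_op c y)%:E) (within (regular_arg W) (nbhs z)).

Definition lsc_op (R : realType) (W : set 'cV[R]_2) (c : 'cV[R]_2 -> R)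
    (z : 'cV[R]_2 * 'cV[R]_2 * 'M[R]_2) : \bar R :=
  limf_einf (fun y => (levelset_op c y)%:E) (within (regular_arg W) (nbhs z)).

Definition cylinder (R : realType) (W : set 'cV[R]_2) : set ('cV[R]_2 * R) :=
  [set z | closure W z.1 /\ 0 < z.2].

Definition closed_cylinder (R : realType) (W : set 'cV[R]_2)
    : set ('cV[R]_2 * R) :=
  [set z | closure W z.1 /\ 0 <= z.2].

Definition time_deriv (R : realType) (phi : 'cV[R]_2 * R -> R)
    (z : 'cV[R]_2 * R) : R :=
  derive1 (fun s : R => phi (z.1, s)) z.2.

Definition space_grad (R : realType) (phi : 'cV[R]_2 * R -> R)
    (z : 'cV[R]_2 * R) : 'cV[R]_2 :=
  grad (fun y => phi (y, z.2)) z.1.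

Definition space_hessian (R : realType) (phi : 'cV[R]_2 * R -> R)
    (z : 'cV[R]_2 * R) : 'M[R]_2 :=
  hessian (fun y => phi (y, z.2)) z.1.

(** The point of the domain of [levelset_op] given by [D(phi - theta)] and
    [D^2(phi - theta)], where [dth] stands for [D theta]. *)
Definition op_arg (R : realType) (dth : 'cV[R]_2 -> 'cV[R]_2)
    (phi : 'cV[R]_2 * R -> R) (z : 'cV[R]_2 * R)
    : 'cV[R]_2 * 'cV[R]_2 * 'M[R]_2 :=
  (z.1, space_grad phi z - dth z.1, space_hessian phi z - jacobian dth z.1).

(** The Neumann condition is imposed in the viscosity sense: at a boundary point
    either the inequality of the equation or that of the boundary condition
    holds.  Test functions are C^2 near the point of contact, which may be a
    point of the lateral boundary. *)
Definition visc_subsolution (R : realType) (W : set 'cV[R]_2)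
    (n : 'cV[R]_2 -> 'cV[R]_2) (c : 'cV[R]_2 -> R)
    (dth : 'cV[R]_2 -> 'cV[R]_2) (u : 'cV[R]_2 * R -> R) : Prop :=
  forall (z0 : 'cV[R]_2 * R) (U : set ('cV[R]_2 * R)) (phi : 'cV[R]_2 * R -> R),
    cylinder W z0 -> open U -> U z0 -> C2_on U phi ->
    (\forall z \near z0, cylinder W z -> u z - phi z <= u z0 - phi z0) ->
    let ineq := ((time_deriv phi z0)%:E <= usc_op W c (op_arg dth phi z0))%E in
    let bc := dot (space_grad phi z0 - dth z0.1) (n z0.1) <= 0 in
    (W z0.1 -> ineq) /\ (boundary W z0.1 -> ineq \/ bc).

Definition visc_supersolution (R : realType) (W : set 'cV[R]_2)
    (n : 'cV[R]_2 -> 'cV[R]_2) (c : 'cV[R]_2 -> R)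
    (dth : 'cV[R]_2 -> 'cV[R]_2) (u : 'cV[R]_2 * R -> R) : Prop :=
  forall (z0 : 'cV[R]_2 * R) (U : set ('cV[R]_2 * R)) (phi : 'cV[R]_2 * R -> R),
    cylinder W z0 -> open U -> U z0 -> C2_on U phi ->
    (\forall z \near z0, cylinder W z -> u z0 - phi z0 <= u z - phi z) ->
    let ineq := (lsc_op W c (op_arg dth phi z0) <= (time_deriv phi z0)%:E)%E in
    let bc := 0 <= dot (space_grad phi z0 - dth z0.1) (n z0.1) in
    (W z0.1 -> ineq) /\ (boundary W z0.1 -> ineq \/ bc).

(** [u] is continuous on [closure W * [0, +oo[] and solves, in the viscosity
    sense,
      u_t = |D(u - theta)| (div (D(u - theta) / |D(u - theta)|) + c)  in W,
      D(u - theta) . n = 0  on the boundary of W,    u(., 0) = u0.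
    The values of [u] outside [closure W * [0, +oo[] are irrelevant. *)
Definition visc_solution (R : realType) (W : set 'cV[R]_2)
    (n : 'cV[R]_2 -> 'cV[R]_2) (c : 'cV[R]_2 -> R)
    (dth : 'cV[R]_2 -> 'cV[R]_2) (u0 : 'cV[R]_2 -> R)
    (u : 'cV[R]_2 * R -> R) : Prop :=
  [/\ {within closed_cylinder W, continuous u},
      visc_subsolution W n c dth u,
      visc_supersolution W n c dth u
    & forall x, closure W x -> u (x, 0) = u0 x].

(* Main.v *)
(** The function [v(x, t) = g(R_{-c0 t} x/|x|) + c0 t] is a classical solution: with
    [L f (y) = y^perp . Df(y)] one has [D(v - theta) = (L g - 1) x^perp / |x|^2], which never
    vanishes because [|Dg| < 1]; its level sets are rays, of zero curvature, so the
    equation reduces to [v_t = c0 (1 - L g) = c |D(v - theta)|], and the Neumann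
    condition holds since [x^perp . x = 0].

    Since [v] is C^2, no doubling of variables is needed to compare it with a viscosity
    solution [u].  If [s (u - v) > 0] somewhere ([s = 1] or [s = -1]), then
    [v + s (A exp(k (t - t1)) + d (|x|^2 - m)^2)], [m = (r1^2 + r2^2) / 2], touches [u]
    for suitable [A], [k] and every small [d].  The last term makes the Neumann inequality
    strict on both circles and perturbs the operator by [O(d)], while the exponential
    contributes a fixed positive amount to [s] times the time derivative: a contradiction.

    For the second claim, [t |-> v(x, t) - c0 t] is periodic and takes every value
    of [g] on the unit circle. *)

Require Import Defs.
From HB Require Import structures.
From mathcomp Require Import all_boot all_order all_algebra.
From mathcomp Require Import all_classical all_reals all_analysis.
From mathcomp Require Import ring lra.
Import Order.TTheory GRing.Theory Num.Theory.
Import numFieldNormedType.Exports.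
Local Open Scope classical_set_scope.
Local Open Scope ring_scope.

(** * Directional derivatives and classes C^1, C^2 *)

(** The value of ['D_v f x] does not witness that the limit exists, so differentiability is carried
    along. The rules below then compute the derivatives in all directions at once, in space and in
    time. *)
Definition has_deriv {R : realType} {V : normedModType R}
  (f : V -> R) (x : V) (L : V -> R) : Prop :=
  differentiable f x /\ forall v, 'D_v f x = L v.

Section HasDeriv.
Context {R : realType} {V : normedModType R}.
Implicit Types (f g : V -> R) (x : V) (L : V -> R).

Lemma has_deriv_eq {f x L} L' : has_deriv f x L -> L =1 L' -> has_deriv f x L'.
Proof. by move=> [df Df] LL'; split=> // v; rewrite Df LL'. Qed.

Lemma has_deriv_cst (a : R) x : has_deriv (fun=> a) x (fun=> 0).
Proof.
split; first exact: differentiable_cst.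
by move=> v; exact: (@derive_cst R V R a x v).
Qed.

Lemma has_derivD {f g x L L'} : has_deriv f x L -> has_deriv g x L' ->
  has_deriv (fun y => f y + g y) x (fun v => L v + L' v).
Proof.
move=> [df Df] [dg Dg]; split; first exact: differentiableD.
by move=> v; rewrite deriveD ?Df ?Dg//; exact: diff_derivable.
Qed.

Lemma has_derivM {f g x L L'} : has_deriv f x L -> has_deriv g x L' ->
  has_deriv (fun y => f y * g y) x (fun v => f x * L' v + g x * L v).
Proof.
move=> [df Df] [dg Dg]; split; first exact: differentiableM.
by move=> v; rewrite deriveM ?Df ?Dg//; exact: diff_derivable.
Qed.

Lemma has_derivV {f x L} : f x != 0 -> has_deriv f x L ->
  has_deriv (fun y => (f y)^-1) x (fun v => - (f x) ^- 2 * L v).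
Proof.
move=> f0 [df Df]; split; first exact: differentiableV.
by move=> v; rewrite deriveV ?Df//; exact: diff_derivable.
Qed.

Lemma has_deriv_comp1 {f x L} {F : R -> R} {F'} :
  has_deriv f x L -> is_derive (f x) 1 F F' ->
  has_deriv (fun y => F (f y)) x (fun v => F' * L v).
Proof.
move=> [df Df] [dF DF].
have dF' : differentiable F (f x) by exact/derivable1_diffP.
have dFf : differentiable (F \o f) x by exact: differentiable_comp.
split=> // v; rewrite -[LHS]/('D_v (F \o f) x) deriveE// diff_comp//= -(deriveE _ df).
by rewrite Df deriv1E// derive1E DF mulrC.
Qed.

Lemma has_deriv_comp2 {F : 'cV[R]_2 -> R} {a b : V -> R} {x La Lb} :
  has_deriv a x La -> has_deriv b x Lb -> differentiable F (vec2 (a x) (b x)) ->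
  has_deriv (fun y => F (vec2 (a y) (b y))) x
    (fun v => La v * 'D_(basis2 R 0) F (vec2 (a x) (b x))
            + Lb v * 'D_(basis2 R 1) F (vec2 (a x) (b x))).
Proof.
move=> [da Da] [db Db] dF.
have E y z : vec2 y z = y *: basis2 R 0 + z *: basis2 R 1.
  apply/matrixP => i j; rewrite !mxE (ord1 j) eqxx !andbT.
  by case: i => -[|[|//]] i /=; rewrite /= ?mulr1 ?mulr0 ?addr0 ?add0r.
have Eab : (fun y => vec2 (a y) (b y)) =
   (fun y => a y *: basis2 R 0) + (fun y => b y *: basis2 R 1).
  by apply/funext => y; rewrite E.
have dab : differentiable (fun y => vec2 (a y) (b y)) x.
  by rewrite Eab; apply: differentiableD; exact: differentiableZl.
have dc : differentiable (F \o (fun y => vec2 (a y) (b y))) x.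
  exact: differentiable_comp.
split=> // v; rewrite -[LHS]/('D_v (F \o (fun y => vec2 (a y) (b y))) x).
rewrite deriveE// diff_comp//=.
have -> : 'd (fun y => vec2 (a y) (b y)) x v =
    La v *: basis2 R 0 + Lb v *: basis2 R 1.
  have Z (c : V -> R) (w : 'cV[R]_2) : differentiable c x ->
      'd (fun y => c y *: w) x v = 'D_v c x *: w.
    by move=> dc'; rewrite diffZl//= deriveE.
  have := congr1 (fun h => h v) (diffD (differentiableZl (basis2 R 0) da)
    (differentiableZl (basis2 R 1) db)).
  by rewrite -Eab => ->; rewrite -Da -Db -(Z _ _ da) -(Z _ _ db).
rewrite linearD [X in X + _]linearZ [X in _ + X]linearZ /=.
by rewrite (deriveE _ dF) (deriveE _ dF).
Qed.

End HasDeriv.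

Section NearDifferentiable.
Context {R : realType} {V W : normedModType R}.
Implicit Types (f g : V -> W) (x : V).

(** Differentiability is local: the remainder of the first-order expansion is constrained only near
    0, where the two functions agree, so ['d f x] serves [g] as well. *)
Lemma near_eq_differentiable f g x :
  (\forall z \near x, f z = g z) -> differentiable f x -> differentiable g x.
Proof.
move=> fg df.
have fgx : f x = g x := nbhs_singleton fg.
have [cd /eqaddoP E] := (diff_locallyP x f).1 df.
have Eg : g \o shift x = cst (g x) + 'd f x +o_ 0 id.
  apply/eqaddoP => e e0; have Ee := E e e0.
  have fg0 : \forall h \near (0 : V), f (h + x) = g (h + x).
    by move: fg; rewrite (near_shift (0 : V) x) subr0.
  apply: filterS2 Ee fg0 => h; rewrite !fctE /= => + fgh.
  by rewrite fgx fgh.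
by apply/diff_locallyP; rewrite (diff_unique cd Eg).
Qed.

End NearDifferentiable.

Section ClassC1.
Context {R : realType} {V : normedModType R} {U : set V}.
Hypothesis oU : open U.
Implicit Types (f g : V -> R) (E : V -> V -> R).

Let nearU x : U x -> \forall y \near x, U y.
Proof. by move=> Ux; exact: open_nbhs_nbhs. Qed.

(** [E x v] is an explicit formula for the derivative. As [U] is open, ['D_v f] coincides with it on
    a neighbourhood of each point and inherits its continuity. *)
Lemma C1_intro f E : (forall x, U x -> has_deriv f x (E x)) ->
  (forall v x, U x -> {for x, continuous (E ^~ v)}) -> C1_on U f.
Proof.
move=> fE cE; split; first by move=> x /fE [].
move=> v x Ux; rewrite /prop_for /continuous_at.
have -> : 'D_v f x = E x v by have [_ ->] := fE x Ux.
apply: cvg_trans (cE v x Ux); apply: near_eq_cvg.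
by apply: filterS (nearU x Ux) => y /fE [_ ->].
Qed.

Lemma C1_eq f g : {in U, f =1 g} -> C1_on U f -> C1_on U g.
Proof.
move=> fg [df Df].
have fgn x : U x -> \forall y \near x, f y = g y.
  by move=> Ux; apply: filterS (nearU x Ux) => y Uy; apply: fg; rewrite inE.
apply: (@C1_intro _ (fun x v => 'D_v f x)) => // x Ux; split.
  exact: near_eq_differentiable (fgn x Ux) (df x Ux).
by move=> v; apply/esym/near_eq_derive/fgn.
Qed.

Lemma C2_intro f E : (forall x, U x -> has_deriv f x (E x)) ->
  (forall v, C1_on U (E ^~ v)) -> C2_on U f.
Proof.
move=> fE cE; split.
  apply: (C1_intro f E fE) => v x Ux.
  exact/differentiable_continuous/(cE v).1.
by move=> v; apply: C1_eq (cE v) => x; rewrite inE => /fE [_ ->].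
Qed.

Lemma C1_has_deriv f x : C1_on U f -> U x -> has_deriv f x (fun v => 'D_v f x).
Proof. by move=> [df _] Ux; split=> //; exact: df. Qed.

Lemma C1_continuous f x : C1_on U f -> U x -> {for x, continuous f}.
Proof. by move=> [df _] Ux; apply: differentiable_continuous; exact: df. Qed.

Lemma C1_cst (a : R) : C1_on U (fun=> a).
Proof.
apply: (@C1_intro _ (fun _ _ => 0)) => [x _|v x _]; first exact: has_deriv_cst.
exact: cvg_cst.
Qed.

Lemma C1D f g : C1_on U f -> C1_on U g -> C1_on U (fun x => f x + g x).
Proof.
move=> Cf Cg; apply: (@C1_intro _ (fun x v => 'D_v f x + 'D_v g x)).
  by move=> x Ux; apply: has_derivD; exact: C1_has_deriv.
by move=> v x Ux; apply: continuousD; [exact: Cf.2|exact: Cg.2].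
Qed.

Lemma C1M f g : C1_on U f -> C1_on U g -> C1_on U (fun x => f x * g x).
Proof.
move=> Cf Cg.
apply: (@C1_intro _ (fun x v => f x * 'D_v g x + g x * 'D_v f x)).
  by move=> x Ux; apply: has_derivM; exact: C1_has_deriv.
move=> v x Ux; apply: continuousD; apply: continuousM.
- exact: C1_continuous.
- exact: Cg.2.
- exact: C1_continuous.
- exact: Cf.2.
Qed.

Lemma C1V f : (forall x, U x -> f x != 0) -> C1_on U f ->
  C1_on U (fun x => (f x)^-1).
Proof.
move=> f0 Cf.
apply: (@C1_intro _ (fun x v => - (f x) ^- 2 * 'D_v f x)).
  move=> x Ux; have f0x := f0 x Ux.
  exact: has_derivV f0x (C1_has_deriv _ _ Cf Ux).
move=> v x Ux; apply: continuousM; last exact: Cf.2.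
apply: continuousN; apply: continuousV; first by rewrite expf_neq0// f0.
by apply: continuousM; exact: C1_continuous.
Qed.

End ClassC1.

Lemma has_deriv_affine {R : realType} {V : normedModType R} (f : V -> R) x L :
  differentiable f x -> (forall v h, f (h *: v + x) - f x = h * L v) ->
  has_deriv f x L.
Proof.
move=> df fL; split=> // v; apply: cvg_lim => //.
apply: cvg_trans (@cvg_cst _ (L v) _ (0^') _).
apply: near_eq_cvg; near=> h; rewrite /= fL /GRing.scale/= mulKf//.
by near: h; exact: nbhs_dnbhs_neq.
Unshelve. all: by end_near. Qed.

(** * The phase [R_{-c0 t} x/|x|] and its derivatives *)

Section Plane.
Context {R : realType}.
Local Notation has_derivT := (@has_deriv R ('cV[R]_2 * R)%type).
Implicit Types (x y : 'cV[R]_2) (z w v : 'cV[R]_2 * R) (a b : R).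

Lemma dotE x y : dot x y = x 0 0 * y 0 0 + x 1 0 * y 1 0.
Proof.
rewrite /dot !big_ord_recl big_ord0 addr0.
by congr (_ + x _ _ * y _ _); apply/val_inj.
Qed.

Lemma vec2_0 a b : vec2 a b 0 0 = a. Proof. by rewrite mxE. Qed.

Lemma vec2_1 a b : vec2 a b 1 0 = b. Proof. by rewrite mxE. Qed.

Lemma vec2_eta x : vec2 (x 0 0) (x 1 0) = x.
Proof.
apply/matrixP => i j; rewrite !mxE (ord1 j).
by case: i => -[|[|//]] i /=; congr (x _ _); apply/val_inj.
Qed.

Lemma plane_eqP x y : x 0 0 = y 0 0 -> x 1 0 = y 1 0 -> x = y.
Proof. by move=> h0 h1; rewrite -(vec2_eta x) -(vec2_eta y) h0 h1. Qed.

Lemma ord2P (i : 'I_2) : i = 0 \/ i = 1.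
Proof. by case: i => -[|[|//]] i; [left|right]; exact/val_inj. Qed.

Lemma dot_basis2 x (i : 'I_2) : dot x (basis2 R i) = x i 0.
Proof.
rewrite dotE !mxE; case: i => -[|[|//]] i /=;
  rewrite ?(mulr1, mulr0, addr0, add0r); congr (x _ _); exact/val_inj.
Qed.

Lemma enorm_ge0 x : 0 <= enorm x. Proof. exact: sqrtr_ge0. Qed.

Lemma sqr_enorm x : enorm x ^+ 2 = x 0 0 ^+ 2 + x 1 0 ^+ 2.
Proof. by rewrite sqr_sqrtr dotE -!expr2// addr_ge0// sqr_ge0. Qed.

Lemma enorm_eq0 x : (enorm x == 0) = (x == 0).
Proof.
rewrite -(sqrf_eq0 (enorm x)) sqr_enorm paddr_eq0 ?sqr_ge0// !sqrf_eq0.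
apply/andP/eqP => [[/eqP x0 /eqP x1]|->]; last by rewrite !mxE eqxx.
by apply: plane_eqP; rewrite mxE.
Qed.

Lemma enorm_gt0 x : (0 < enorm x) = (x != 0).
Proof. by rewrite lt_def enorm_ge0 andbT enorm_eq0. Qed.

Lemma rotationE (phi : R) x : rotation phi *m x =
  vec2 (cos phi * x 0 0 - sin phi * x 1 0) (sin phi * x 0 0 + cos phi * x 1 0).
Proof.
apply: plane_eqP; rewrite !mxE !big_ord_recl big_ord0 addr0 !mxE /=.
  by rewrite mulNr; congr (_ * x _ _ - _ * x _ _); apply/val_inj.
by congr (_ * x _ _ + _ * x _ _); apply/val_inj.
Qed.

Lemma cvg_vec2 {T : Type} (F : set_system T) {FF : Filter F} (f g : T -> R) a b :
  f @ F --> a -> g @ F --> b -> (fun t => vec2 (f t) (g t)) @ F --> vec2 a b.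
Proof.
have E c d : vec2 c d = c *: basis2 R 0 + d *: basis2 R 1.
  by apply: plane_eqP; rewrite !mxE/= !(mulr1, mulr0, addr0, add0r).
move=> fa gb; rewrite E; under eq_cvg do rewrite E.
by apply: cvgD; apply: cvgZ => //; exact: cvg_cst.
Qed.

Lemma enorm_continuous : continuous (@enorm R).
Proof.
move=> x; apply: (@continuous_comp _ _ _ (fun x => dot x x) Num.sqrt).
  have -> : (fun x => dot x x) = (fun x : 'cV[R]_2 => x 0 0 * x 0 0 + x 1 0 * x 1 0).
    by apply/funext => y; rewrite dotE.
  by apply: continuousD; apply: continuousM; exact: coord_continuous.
exact: sqrt_continuous.
Qed.

Lemma has_deriv_coord i z :
  has_derivT (fun w => w.1 i 0) z (fun v => v.1 i 0).
Proof.
apply: has_deriv_affine; last by move=> v h; rewrite /= !mxE addrK.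
apply: (@differentiable_comp _ _ _ _ (@fst _ _) (fun x : 'cV[R]_2 => x i 0)).
  apply: linear_differentiable; by move=> w; exact: cvg_fst.
exact: differentiable_coord.
Qed.

Lemma has_deriv_time z : has_derivT (fun w => w.2) z (fun v => v.2).
Proof.
apply: has_deriv_affine; last by move=> v h; rewrite /= addrK.
apply: linear_differentiable; by move=> w; exact: cvg_snd.
Qed.

Lemma has_deriv_sqr_enorm z : has_derivT (fun w => enorm w.1 ^+ 2) z
  (fun v => 2 * dot z.1 v.1).
Proof.
have -> : (fun w => enorm w.1 ^+ 2) =
    fun w : 'cV[R]_2 * R => w.1 0 0 * w.1 0 0 + w.1 1 0 * w.1 1 0.
  by apply/funext => w; rewrite sqr_enorm !expr2.
apply: has_deriv_eq (has_derivD (has_derivM (has_deriv_coord 0 z)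
  (has_deriv_coord 0 z)) (has_derivM (has_deriv_coord 1 z) (has_deriv_coord 1 z))) _.
by move=> v; rewrite dotE; ring.
Qed.

(** The norm is the square root of a polynomial that is positive off the origin; the chain rule for
    the root and for the inverse does the rest. *)
Lemma has_deriv_invr_enorm z : z.1 != 0 ->
  has_derivT (fun w => (enorm w.1)^-1) z
    (fun v => - (enorm z.1)^-1 ^+ 3 * dot z.1 v.1).
Proof.
move=> z0; have n0 : enorm z.1 != 0 by rewrite enorm_eq0.
have ng0 : 0 < enorm z.1 by rewrite enorm_gt0.
have -> : (fun w => (enorm w.1)^-1) =
    fun w : 'cV[R]_2 * R => (Num.sqrt (enorm w.1 ^+ 2))^-1.
  by apply/funext => w; rewrite sqrtr_sqr ger0_norm// enorm_ge0.
have sg : 0 < enorm z.1 ^+ 2 by rewrite exprn_gt0.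
have := has_derivV _ (has_deriv_comp1 (has_deriv_sqr_enorm z) (is_derive1_sqrt sg)).
rewrite sqrtr_sqr ger0_norm ?enorm_ge0// => /(_ n0) /has_deriv_eq; apply => v.
by field.
Qed.

Lemma DthetaE x : Dtheta x = vec2 (- x 1 0 / enorm x ^+ 2) (x 0 0 / enorm x ^+ 2).
Proof. by apply: plane_eqP; rewrite !mxE/= mulrC. Qed.

End Plane.

Section Phase.
Context {R : realType} (c0 : R).
Local Notation has_derivT := (@has_deriv R ('cV[R]_2 * R)%type).
Implicit Types (x y : 'cV[R]_2) (z w v : 'cV[R]_2 * R).

Definition phase z : 'cV[R]_2 :=
  rotation (- (c0 * z.2)) *m ((enorm z.1)^-1 *: z.1).

(* The differential of the multivalued angle [theta - c0 t] of [phase]. *)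
Definition dphase z v : R := dot (Dtheta z.1) v.1 - c0 * v.2.

Lemma phase0 z : phase z 0 0 =
  (cos (c0 * z.2) * z.1 0 0 + sin (c0 * z.2) * z.1 1 0) * (enorm z.1)^-1.
Proof. by rewrite /phase rotationE vec2_0 cosN sinN !mxE; ring. Qed.

Lemma phase1 z : phase z 1 0 =
  (cos (c0 * z.2) * z.1 1 0 + - sin (c0 * z.2) * z.1 0 0) * (enorm z.1)^-1.
Proof. by rewrite /phase rotationE vec2_1 cosN sinN !mxE; ring. Qed.

Lemma enorm_phase z : z.1 != 0 -> enorm (phase z) = 1.
Proof.
move=> z0; have n0 : enorm z.1 != 0 by rewrite enorm_eq0.
apply/eqP; rewrite -(@eqrXn2 _ 2) ?enorm_ge0// expr1n; apply/eqP.
rewrite sqr_enorm phase0 phase1.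
have := cos2Dsin2 (c0 * z.2); have := sqr_enorm z.1.
move: n0; move: (enorm z.1) (cos _) (sin _) (z.1 0 0) (z.1 1 0) => n c s x0 x1 n0.
move=> nE cs; transitivity ((c ^+ 2 + s ^+ 2) * (x0 ^+ 2 + x1 ^+ 2) / n ^+ 2).
  by field.
by rewrite cs -nE mul1r divff// expf_neq0.
Qed.

Let has_deriv_scaled_time z : has_derivT (fun w => c0 * w.2) z (fun v => c0 * v.2).
Proof.
by apply: has_deriv_eq (has_derivM (has_deriv_cst c0 z) (has_deriv_time z)) _ => v;
  ring.
Qed.

(** The phase is [(cos alpha, sin alpha)] for the multivalued angle [alpha = theta - c0 t], so this
    is the derivative of a cosine. It is checked in coordinates, and no branch of the angle has to
    be chosen. *)
Lemma has_deriv_phase0 z : z.1 != 0 ->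
  has_derivT (fun w => phase w 0 0) z (fun v => - phase z 1 0 * dphase z v).
Proof.
move=> z0; have n0 : enorm z.1 != 0 by rewrite enorm_eq0.
under eq_fun do rewrite phase0.
have Dc := has_deriv_comp1 (has_deriv_scaled_time z) (is_derive_cos (c0 * z.2)).
have Ds := has_deriv_comp1 (has_deriv_scaled_time z) (is_derive_sin (c0 * z.2)).
apply: has_deriv_eq (has_derivM (has_derivD (has_derivM Dc (has_deriv_coord 0 z))
  (has_derivM Ds (has_deriv_coord 1 z))) (has_deriv_invr_enorm z z0)) _ => v /=.
rewrite phase1 /dphase DthetaE !dotE vec2_0 vec2_1.
have := sqr_enorm z.1; move: n0.
move: (enorm z.1) (cos _) (sin _) (z.1 0 0) (z.1 1 0) => n c s x0 x1 n0 nE.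
have x0E : x0 ^+ 2 = n ^+ 2 - x1 ^+ 2 by rewrite nE addrK.
by field: x0E.
Qed.

Lemma has_deriv_phase1 z : z.1 != 0 ->
  has_derivT (fun w => phase w 1 0) z (fun v => phase z 0 0 * dphase z v).
Proof.
move=> z0; have n0 : enorm z.1 != 0 by rewrite enorm_eq0.
under eq_fun do rewrite phase1.
have Dc := has_deriv_comp1 (has_deriv_scaled_time z) (is_derive_cos (c0 * z.2)).
have Ds := has_derivM (has_deriv_cst (-1) z)
  (has_deriv_comp1 (has_deriv_scaled_time z) (is_derive_sin (c0 * z.2))).
have := has_derivM (has_derivD (has_derivM Dc (has_deriv_coord 1 z))
  (has_derivM Ds (has_deriv_coord 0 z))) (has_deriv_invr_enorm z z0).
under eq_fun do rewrite mulN1r.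
move=> /has_deriv_eq; apply => v /=.
rewrite phase0 /dphase DthetaE !dotE vec2_0 vec2_1.
have := sqr_enorm z.1; move: n0.
move: (enorm z.1) (cos _) (sin _) (z.1 0 0) (z.1 1 0) => n c s x0 x1 n0 nE.
have x0E : x0 ^+ 2 = n ^+ 2 - x1 ^+ 2 by rewrite nE addrK.
by field: x0E.
Qed.

Lemma phase_continuous z : z.1 != 0 -> {for z, continuous phase}.
Proof.
move=> z0; rewrite /prop_for /continuous_at -(vec2_eta (phase z)).
have -> : phase = fun w => vec2 (phase w 0 0) (phase w 1 0).
  by apply/funext => w; rewrite vec2_eta.
have [d0 _] := has_deriv_phase0 z z0; have [d1 _] := has_deriv_phase1 z z0.
rewrite vec2_0 vec2_1.
by apply: cvg_vec2; [exact: differentiable_continuous d0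
  |exact: differentiable_continuous d1].
Qed.

End Phase.

(** * The angular derivative and composition with the phase *)

Section AngularDerivative.
Context {R : realType} (c0 : R).
Local Notation has_derivT := (@has_deriv R ('cV[R]_2 * R)%type).
Implicit Types (x y : 'cV[R]_2) (z w v : 'cV[R]_2 * R) (f : 'cV[R]_2 -> R).

(** This is the operator [L]: the derivative of [f] at [x] along the rotation about the origin. *)
Definition angular f x : R :=
  - x 1 0 * 'D_(basis2 R 0) f x + x 0 0 * 'D_(basis2 R 1) f x.

(** The phase moves along the unit circle: its differential is [dphase] times
    [perp (phase c0 z)]. *)
Lemma has_deriv_comp_phase f z : z.1 != 0 -> differentiable f (phase c0 z) ->
  has_derivT (fun w => f (phase c0 w)) z
    (fun v => angular f (phase c0 z) * dphase c0 z v).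
Proof.
move=> z0 df; under eq_fun do rewrite -(vec2_eta (phase c0 _)).
rewrite -(vec2_eta (phase c0 z)) in df.
apply: has_deriv_eq (has_deriv_comp2 (has_deriv_phase0 c0 z z0)
  (has_deriv_phase1 c0 z z0) df) _ => v.
by rewrite vec2_eta /angular; ring.
Qed.

(** This open set serves as [U] for every test function. It contains the closed cylinder over the
    annulus, so contact at the lateral boundary is covered as well. *)
Definition off_axis : set ('cV[R]_2 * R) := [set z | z.1 != 0].

Lemma open_off_axis : open off_axis.
Proof.
have -> : off_axis = (fun z => enorm z.1) @^-1` [set a | 0 < a].
  by apply/seteqP; split=> z /=; rewrite enorm_gt0.
apply: open_comp; last exact: open_gt.
by move=> z _; apply: (@continuous_comp _ _ _ fst (@enorm R));
  [exact: cvg_fst|exact: enorm_continuous].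
Qed.

Let C1_intro_off := @C1_intro R ('cV[R]_2 * R)%type _ open_off_axis.

Lemma C1_coord i : C1_on off_axis (fun z => z.1 i 0).
Proof.
apply: (@C1_intro_off _ (fun _ v => v.1 i 0)) => [z _|v z _].
  exact: has_deriv_coord.
exact: cvg_cst.
Qed.

Lemma C1_sqr_enorm : C1_on off_axis (fun z => enorm z.1 ^+ 2).
Proof.
have -> : (fun z => enorm z.1 ^+ 2) =
    fun w : 'cV[R]_2 * R => w.1 0 0 * w.1 0 0 + w.1 1 0 * w.1 1 0.
  by apply/funext => w; rewrite sqr_enorm !expr2.
by apply: (C1D open_off_axis); apply: (C1M open_off_axis); exact: C1_coord.
Qed.

Lemma C1_dphase v : C1_on off_axis (fun z => dphase c0 z v).
Proof.
have -> : (fun z => dphase c0 z v) = fun z : 'cV[R]_2 * R =>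
    (z.1 1 0 * (- v.1 0 0) + z.1 0 0 * v.1 1 0) * (enorm z.1 ^+ 2)^-1
    + - (c0 * v.2).
  apply/funext => z; rewrite /dphase DthetaE dotE vec2_0 vec2_1; ring.
apply: (C1D open_off_axis); last exact: (C1_cst open_off_axis).
apply: (C1M open_off_axis).
  by apply: (C1D open_off_axis); apply: (C1M open_off_axis);
    [exact: C1_coord|exact: (C1_cst open_off_axis)
    |exact: C1_coord|exact: (C1_cst open_off_axis)].
apply: (C1V open_off_axis); last exact: C1_sqr_enorm.
by move=> z /= z0; rewrite sqrf_eq0 enorm_eq0.
Qed.

Lemma angular_continuous f : C1_on setT f -> continuous (angular f).
Proof.
move=> Cf x.
apply: (@continuousD _ _ _ (fun x => - x 1 0 * 'D_(basis2 R 0) f x)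
  (fun x => x 0 0 * 'D_(basis2 R 1) f x)); apply: continuousM.
- by apply: continuousN; exact: coord_continuous.
- exact: Cf.2.
- exact: coord_continuous.
- exact: Cf.2.
Qed.

Lemma C1_coord_plane i : C1_on setT (fun x : 'cV[R]_2 => x i 0).
Proof.
apply: (@C1_intro _ _ _ openT _ (fun _ v : 'cV[R]_2 => v i 0)) => [x _|v x _].
  apply: has_deriv_affine; first exact: differentiable_coord.
  by move=> v h; rewrite !mxE addrK.
by apply: cst_continuous.
Qed.

Lemma C1_angular f : C2_on setT f -> C1_on setT (angular f).
Proof.
move=> [_ Cf]; apply: (C1D openT); apply: (C1M openT); last exact: Cf.
- have -> : (fun x => - x 1 0) = fun x : 'cV[R]_2 => (-1) * x 1 0.
    by apply/funext => x; rewrite mulN1r.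
  by apply: (C1M openT); [exact: (C1_cst openT)|exact: C1_coord_plane].
- exact: Cf.
- exact: C1_coord_plane.
Qed.

Lemma C1_comp_phase f : C1_on setT f -> C1_on off_axis (fun z => f (phase c0 z)).
Proof.
move=> Cf; apply: (@C1_intro_off _
    (fun z v => angular f (phase c0 z) * dphase c0 z v)).
  by move=> z z0; apply: has_deriv_comp_phase => //; exact: Cf.1.
move=> v z z0; apply: continuousM.
  apply: (@continuous_comp _ _ _ (phase c0) (angular f)).
    exact: phase_continuous.
  exact: angular_continuous.
by apply: (C1_continuous (U := off_axis)) => //; exact: C1_dphase.
Qed.

End AngularDerivative.

(** * Space and time derivatives as directional derivatives in the product *)

Section SliceDerivatives.
Context {R : realType}.
Implicit Types (phi : 'cV[R]_2 * R -> R) (x e : 'cV[R]_2) (t : R).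

Lemma derive_space_slice phi x t e :
  'D_e (fun y => phi (y, t)) x = 'D_(e, 0) phi (x, t).
Proof.
rewrite /derive; set F := fun h => _; set G := fun h => _.
suff -> : F = G by [].
apply/funext => h; rewrite /F /G.
suff -> : (phi \o shift (x, t)) (h *: (e, 0)) = phi (h *: e + x, t) by [].
by have {2}-> : t = h * 0 + t by rewrite mulr0 add0r.
Qed.

Lemma time_derivE phi (z : 'cV[R]_2 * R) : time_deriv phi z = 'D_(0, 1) phi z.
Proof.
case: z => x t; rewrite /time_deriv derive1E.
rewrite /derive; set F := fun h => _; set G := fun h => _.
suff -> : F = G by [].
apply/funext => h; rewrite /F /G.
suff -> : (phi \o shift (x, t)) (h *: (0, 1)) = phi (x, h *: 1 + t) by [].
by have {2}-> : x = h *: 0 + x by rewrite scaler0 add0r.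
Qed.

End SliceDerivatives.

(** * The test functions and their derivatives up to order two *)

Section TestFunction.
Context {R : realType} (c0 : R) (g : 'cV[R]_2 -> R) (hg : C2_on setT g).
Context (A k t1 q m : R).
Local Notation has_derivT := (@has_deriv R ('cV[R]_2 * R)%type).
Implicit Types (x y : 'cV[R]_2) (z w v : 'cV[R]_2 * R).

Definition profile z : R := g (phase c0 z) + c0 * z.2.

(** [A] and [q] may have either sign: the comparison takes [s * A] and [s * d] with [s = 1] or
    [s = -1]. *)
Definition barrier z : R :=
  A * expR (k * (z.2 - t1)) + q * (enorm z.1 ^+ 2 - m) ^+ 2.

Definition test_fun z : R := profile z + barrier z.

Lemma has_deriv_exp_time z : has_derivT (fun w => A * expR (k * (w.2 - t1))) z
  (fun v => k * (A * expR (k * (z.2 - t1))) * v.2).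
Proof.
have D1 := has_derivM (has_deriv_cst k z)
  (has_derivD (has_deriv_time z) (has_deriv_cst (- t1) z)).
apply: has_deriv_eq (has_derivM (has_deriv_cst A z)
  (has_deriv_comp1 D1 (is_derive_expR _))) _ => v /=; ring.
Qed.

Lemma has_deriv_wall z :
  has_derivT (fun w => q * (enorm w.1 ^+ 2 - m) ^+ 2) z
    (fun v => 4 * q * (enorm z.1 ^+ 2 - m) * dot z.1 v.1).
Proof.
have D1 := has_derivD (has_deriv_sqr_enorm z) (has_deriv_cst (- m) z).
under eq_fun do rewrite expr2.
by apply: has_deriv_eq (has_derivM (has_deriv_cst q z) (has_derivM D1 D1)) _ => v /=;
  ring.
Qed.

Lemma has_deriv_test z : z.1 != 0 -> has_derivT test_fun z (fun v =>
  angular g (phase c0 z) * dphase c0 z v + c0 * v.2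
  + (k * (A * expR (k * (z.2 - t1))) * v.2
     + 4 * q * (enorm z.1 ^+ 2 - m) * dot z.1 v.1)).
Proof.
move=> z0; apply: has_derivD.
  apply: has_derivD; first exact: has_deriv_comp_phase (hg.1.1 _ _).
  by apply: has_deriv_eq (has_derivM (has_deriv_cst c0 z) (has_deriv_time z)) _ => v;
    ring.
by apply: has_derivD; [exact: has_deriv_exp_time|exact: has_deriv_wall].
Qed.

Let oU := @open_off_axis R.

Lemma C1_dot v : C1_on off_axis (fun z => dot z.1 v.1).
Proof.
under eq_fun do rewrite dotE.
by apply: (C1D oU); apply: (C1M oU);
  [exact: C1_coord|exact: (C1_cst oU)|exact: C1_coord|exact: (C1_cst oU)].
Qed.

Lemma C2_test : C2_on off_axis test_fun.
Proof.
apply: (C2_intro oU _ _ has_deriv_test) => v.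
apply: (C1D oU); apply: (C1D oU).
- apply: (C1M oU); last exact: C1_dphase.
  exact/C1_comp_phase/C1_angular.
- exact: (C1_cst oU).
- apply: (C1M oU); last exact: (C1_cst oU).
  apply: (C1M oU); first exact: (C1_cst oU).
  apply: (C1_intro oU _ _ (fun z _ => has_deriv_exp_time z)) => w z z0.
  apply: continuousM; last exact: cst_continuous.
  apply: continuousM; first exact: cst_continuous.
  by apply: differentiable_continuous; have [] := has_deriv_exp_time z.
- apply: (C1M oU); last exact: C1_dot.
  apply: (C1M oU); first exact: (C1_cst oU).
  by apply: (C1D oU); [exact: C1_sqr_enorm|exact: (C1_cst oU)].
Qed.

Lemma time_deriv_test z : z.1 != 0 -> time_deriv test_fun z =
  c0 * (1 - angular g (phase c0 z)) + k * (A * expR (k * (z.2 - t1))).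
Proof.
move=> z0; rewrite time_derivE; have [_ ->] := has_deriv_test z z0.
by rewrite /dphase !dotE !mxE /=; ring.
Qed.

Lemma space_grad_test z i : z.1 != 0 -> space_grad test_fun z i 0 =
  angular g (phase c0 z) * Dtheta z.1 i 0
  + 4 * q * (enorm z.1 ^+ 2 - m) * z.1 i 0.
Proof.
case: z => x t z0; rewrite mxE /= derive_space_slice.
have [_ ->] := has_deriv_test (x, t) z0.
by rewrite /dphase !dot_basis2 /=; ring.
Qed.

(** The Hessian of the angle is [-(x (x^perp)^T + x^perp x^T) / |x|^4]. Only the values of [L] on
    the spatial basis vectors matter later, hence the existential. *)
Lemma has_deriv_Dtheta z i : z.1 != 0 ->
  exists L, has_derivT (fun w => Dtheta w.1 i 0) z L /\
    forall j, L (basis2 R j, 0) = - (enorm z.1 ^+ 2) ^- 2 *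
      (z.1 i 0 * perp z.1 j 0 + perp z.1 i 0 * z.1 j 0).
Proof.
move=> z0; have n0 : enorm z.1 != 0 by rewrite enorm_eq0.
have n20 : enorm z.1 ^+ 2 != 0 by rewrite sqrf_eq0.
have DV := @has_derivV _ _ (fun w : 'cV[R]_2 * R => enorm w.1 ^+ 2) _ _ n20
  (has_deriv_sqr_enorm z).
have x0E : z.1 0 0 ^+ 2 = enorm z.1 ^+ 2 - z.1 1 0 ^+ 2.
  by rewrite sqr_enorm addrK.
have [->|->] := ord2P i.
- have -> : (fun w => Dtheta w.1 0 0) =
      fun w : 'cV[R]_2 * R => (-1 * w.1 1 0) * (enorm w.1 ^+ 2)^-1.
    by apply/funext => w; rewrite DthetaE vec2_0; ring.
  eexists; split.
    exact: has_derivM (has_derivM (has_deriv_cst (-1) z) (has_deriv_coord 1 z)) DV.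
  move=> j; rewrite /= dot_basis2 /perp vec2_0 {DV}.
  have [->|->] := ord2P j; rewrite ?vec2_0 ?vec2_1 !mxE /=;
    move: (z.1 0 0) (z.1 1 0) (enorm _) x0E n0 => x0 x1 n x0E n0; by field: x0E.
- have -> : (fun w => Dtheta w.1 1 0) =
      fun w : 'cV[R]_2 * R => w.1 0 0 * (enorm w.1 ^+ 2)^-1.
    by apply/funext => w; rewrite DthetaE vec2_1.
  eexists; split; first exact: has_derivM (has_deriv_coord 0 z) DV.
  move=> j; rewrite /= dot_basis2 /perp vec2_1 {DV}.
  have [->|->] := ord2P j; rewrite ?vec2_0 ?vec2_1 !mxE /=;
    move: (z.1 0 0) (z.1 1 0) (enorm _) x0E n0 => x0 x1 n x0E n0; by field: x0E.
Qed.

Lemma jacobian_Dtheta x i j : x != 0 -> Defs.jacobian (@Dtheta R) x i j =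
  - (enorm x ^+ 2) ^- 2 * (x i 0 * perp x j 0 + perp x i 0 * x j 0).
Proof.
move=> x0; have [L [[_ DL] LE]] := has_deriv_Dtheta (x, 0) i x0.
rewrite mxE (derive_space_slice (fun w => Dtheta w.1 i 0) x 0) DL; exact: LE.
Qed.

(** The first two terms come from the product rule applied to [(L g)(phase) Dtheta], the last two
    from the wall term. *)
Lemma space_hessian_test z i j : z.1 != 0 -> space_hessian test_fun z i j =
  angular (angular g) (phase c0 z) * (Dtheta z.1 i 0 * Dtheta z.1 j 0)
  + angular g (phase c0 z) * Defs.jacobian (@Dtheta R) z.1 i j
  + 4 * q * (enorm z.1 ^+ 2 - m) * (i == j)%:R + 8 * q * (z.1 i 0 * z.1 j 0).
Proof.
case: z => x t z0.
have [L [DL LE]] := has_deriv_Dtheta (x, t) i z0.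
have Dg := has_deriv_comp_phase c0 _ _ z0 ((C1_angular g hg).1 (phase c0 (x, t)) I).
have Dn := has_derivM (has_derivD (has_deriv_sqr_enorm (x, t))
  (has_deriv_cst (- m) (x, t))) (has_deriv_coord i (x, t)).
have [_ D] := has_derivD (has_derivM Dg DL)
  (has_derivM (has_deriv_cst (4 * q) (x, t)) Dn).
rewrite mxE -/(space_grad _ _).
transitivity ('D_(basis2 R j, 0) (fun w => angular g (phase c0 w) *
   Dtheta w.1 i 0 + 4 * q * ((enorm w.1 ^+ 2 - m) * w.1 i 0)) (x, t)).
  rewrite -derive_space_slice; apply: near_eq_derive.
  (* The gradient formula holds only off the origin, hence near [x]; the neighbourhood is the slice
     at time [t] of one in the product. *)
  have : \forall w \near x, off_axis (w, t).
    have := open_nbhs_nbhs (conj oU z0).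
    by case=> -[P Q] /= [xP tQ] PQ; apply: filterS xP => y Py; apply: PQ;
      split => //=; exact: nbhs_singleton tQ.
  apply: filterS => y y0.
  by rewrite (space_grad_test (y, t) i y0)/=; ring.
rewrite D /= LE jacobian_Dtheta // /dphase !dot_basis2 /=.
have -> : (basis2 R j) i 0 = (i == j)%:R by rewrite mxE eqxx andbT.
ring.
Qed.

End TestFunction.

(** * The level-set operator at the test functions *)

Section Envelopes.
Context {R : realType} {X : topologicalType}.
Implicit Types (f : X -> R) (F : set_system X) (l : R).

(** The set where [f <= l + e] belongs to the filter, so the supremum over it competes in the
    infimum that defines the upper limit. *)
Lemma limf_esup_le f F l : (forall e, 0 < e -> F [set y | f y <= l + e]) ->
  (limf_esup (fun y => (f y)%:E) F <= l%:E)%E.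
Proof.
move=> Fl; apply/lee_addgt0Pr => e e0; apply: le_trans (ereal_inf_lbound _) _.
  by exists [set y | f y <= l + e]; [exact: Fl|reflexivity].
by apply: ge_ereal_sup => _ [y /= fy <-]; rewrite -EFinD lee_fin.
Qed.

Lemma limf_einf_ge f F l : (forall e, 0 < e -> F [set y | l - e <= f y]) ->
  (l%:E <= limf_einf (fun y => (f y)%:E) F)%E.
Proof.
move=> Fl; rewrite /limf_einf leeNr -EFinN.
apply: (limf_esup_le (fun y => - f y)) => e e0.
have -> : [set y | - f y <= - l + e] = [set y | l - e <= f y].
  by apply/seteqP; split=> y /=; lra.
exact: Fl.
Qed.

End Envelopes.

Section LevelSetOperator.
Context {R : realType}.
Implicit Types (x p : 'cV[R]_2) (c : 'cV[R]_2 -> R) (X : 'M[R]_2).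

Lemma levelset_opE c x p X : levelset_op c (x, p, X) =
  X 0 0 + X 1 1 - (enorm p ^+ 2)^-1 * (p 0 0 ^+ 2 * X 0 0
    + p 0 0 * p 1 0 * (X 0 1 + X 1 0) + p 1 0 ^+ 2 * X 1 1) + c x * enorm p.
Proof.
rewrite /levelset_op; congr (_ + _).
have S (f : 'I_2 -> R) : \sum_i f i = f 0 + f 1.
  by rewrite !big_ord_recl big_ord0 addr0; congr (_ + f _); exact/val_inj.
have S1 (f : 'I_1 -> R) : \sum_i f i = f 0.
  by rewrite big_ord_recl big_ord0 addr0.
by rewrite /mxtrace S !mxE !S !mxE !S1 !mxE /=; ring.
Qed.

(** The only singular factor is [(enorm p ^+ 2)^-1], which is continuous where [p != 0]; everything
    else is polynomial or a norm. *)
Lemma levelset_op_continuous c x p X : continuous c -> p != 0 ->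
  {for (x, p, X), continuous (levelset_op c)}.
Proof.
move=> cc p0.
have -> : levelset_op c = fun z : 'cV[R]_2 * 'cV[R]_2 * 'M[R]_2 =>
    z.2 0 0 + z.2 1 1 - (enorm z.1.2 ^+ 2)^-1 * (z.1.2 0 0 ^+ 2 * z.2 0 0
    + z.1.2 0 0 * z.1.2 1 0 * (z.2 0 1 + z.2 1 0) + z.1.2 1 0 ^+ 2 * z.2 1 1)
    + c z.1.1 * enorm z.1.2.
  by apply/funext => -[[y r] Y]; rewrite levelset_opE.
set z0 := (x, p, X).
have cX i j : {for z0, continuous
    (fun z : 'cV[R]_2 * 'cV[R]_2 * 'M[R]_2 => z.2 i j)}.
  apply: (@continuous_comp _ _ _ snd (fun Y : 'M[R]_2 => Y i j)).
    exact: cvg_snd.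
  exact: coord_continuous.
have cp2 : {for z0, continuous (fun z : 'cV[R]_2 * 'cV[R]_2 * 'M[R]_2 => z.1.2)}.
  apply: (@continuous_comp _ _ _ fst snd); first exact: cvg_fst.
  exact: cvg_snd.
have cx1 : {for z0, continuous (fun z : 'cV[R]_2 * 'cV[R]_2 * 'M[R]_2 => z.1.1)}.
  apply: (@continuous_comp _ _ _ fst fst); first exact: cvg_fst.
  exact: cvg_fst.
have cp i : {for z0, continuous
    (fun z : 'cV[R]_2 * 'cV[R]_2 * 'M[R]_2 => z.1.2 i 0)}.
  apply: (@continuous_comp _ _ _ (fun z => z.1.2) (fun y : 'cV[R]_2 => y i 0)) => //.
  exact: coord_continuous.
have cn : {for z0, continuous
    (fun z : 'cV[R]_2 * 'cV[R]_2 * 'M[R]_2 => enorm z.1.2)}.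
  apply: (@continuous_comp _ _ _ (fun z => z.1.2) (@enorm R)) => //.
  exact: enorm_continuous.
have cc1 : {for z0, continuous
    (fun z : 'cV[R]_2 * 'cV[R]_2 * 'M[R]_2 => c z.1.1)}.
  by apply: (@continuous_comp _ _ _ (fun z => z.1.1) c) => //; exact: cc.
have cM (f h : 'cV[R]_2 * 'cV[R]_2 * 'M[R]_2 -> R) : {for z0, continuous f} ->
    {for z0, continuous h} -> {for z0, continuous (fun z => f z * h z)}.
  by move=> cf ch; exact: (continuousM cf ch).
have cD (f h : 'cV[R]_2 * 'cV[R]_2 * 'M[R]_2 -> R) : {for z0, continuous f} ->
    {for z0, continuous h} -> {for z0, continuous (fun z => f z + h z)}.
  by move=> cf ch; exact: (continuousD cf ch).
have n0 : enorm z0.1.2 ^+ 2 != 0 by rewrite sqrf_eq0 enorm_eq0.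
have cV : {for z0, continuous
    (fun z : 'cV[R]_2 * 'cV[R]_2 * 'M[R]_2 => (enorm z.1.2 ^+ 2)^-1)}.
  apply: (@continuousV _ _
    (fun z : 'cV[R]_2 * 'cV[R]_2 * 'M[R]_2 => enorm z.1.2 ^+ 2) z0 n0).
  exact: (cM _ _ cn cn).
apply: (cD _ _ _ (cM _ _ cc1 cn)); apply: (cD); first exact: (cD _ _ (cX 0 0) (cX 1 1)).
apply: continuousN; apply: (cM _ _ cV); apply: (cD).
  apply: (cD _ _ (cM _ _ (cM _ _ (cp 0) (cp 0)) (cX 0 0))).
  exact: (cM _ _ (cM _ _ (cp 0) (cp 1)) (cD _ _ (cX 0 1) (cX 1 0))).
exact: (cM _ _ (cM _ _ (cp 1) (cp 1)) (cX 1 1)).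
Qed.

(** By continuity the operator stays below its value plus [e] near the point, hence so does its
    upper limit. This bound and its dual replace the envelopes by true values in the viscosity
    inequalities. *)
Lemma usc_op_le W c x p X : continuous c -> p != 0 ->
  (usc_op W c (x, p, X) <= (levelset_op c (x, p, X))%:E)%E.
Proof.
move=> cc p0; apply: limf_esup_le => e e0.
have /cvgrPdist_le /(_ e e0) := levelset_op_continuous c x p X cc p0.
by apply: filterS => z /= + _; rewrite ler_norml => /andP[+ _]; lra.
Qed.

Lemma lsc_op_ge W c x p X : continuous c -> p != 0 ->
  ((levelset_op c (x, p, X))%:E <= lsc_op W c (x, p, X))%E.
Proof.
move=> cc p0; apply: limf_einf_ge => e e0.
have /cvgrPdist_le /(_ e e0) := levelset_op_continuous c x p X cc p0.
by apply: filterS => z /= + _; rewrite ler_norml => /andP[_ +]; lra.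
Qed.

End LevelSetOperator.

(** * Size of the perturbation of the operator *)

Section OperatorEstimate.
Context {R : realType}.

(** Multiplied by [n], the root becomes the length of [(s, b n^2)], which lies between [s] and
    [s + |b| n^2]. *)
Lemma sqrt_sumsq_bounds (s b n : R) : 0 < n -> 0 <= s ->
  s <= n * Num.sqrt (s ^+ 2 / n ^+ 2 + b ^+ 2 * n ^+ 2) <= s + `|b| * n ^+ 2.
Proof.
move=> n0 s0; have nn : n != 0 by rewrite gt_eqF.
have b0 := normr_ge0 b.
have -> : n * Num.sqrt (s ^+ 2 / n ^+ 2 + b ^+ 2 * n ^+ 2) =
    Num.sqrt (s ^+ 2 + b ^+ 2 * n ^+ 4).
  rewrite -{1}(gtr0_norm n0) -sqrtr_sqr -sqrtrM ?sqr_ge0//; congr Num.sqrt.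
  by field.
have n2 : 0 <= n ^+ 2 by rewrite sqr_ge0.
have bn : 0 <= `|b| * n ^+ 2 by rewrite mulr_ge0.
apply/andP; split.
  rewrite -{1}(ger0_norm s0) -sqrtr_sqr ler_wsqrtr// lerDl.
  by rewrite mulr_ge0 ?sqr_ge0// exprn_ge0// ltW.
have -> : s + `|b| * n ^+ 2 = Num.sqrt ((s + `|b| * n ^+ 2) ^+ 2).
  by rewrite sqrtr_sqr [RHS]ger0_norm// addr_ge0.
rewrite ler_wsqrtr//.
have -> : (s + `|b| * n ^+ 2) ^+ 2 =
    s ^+ 2 + `|b| ^+ 2 * n ^+ 4 + 2 * (s * (`|b| * n ^+ 2)) by ring.
by rewrite real_normK ?num_real// lerDl mulr_ge0// mulr_ge0.
Qed.

(** Here [n] is [|x|], [s] is [1 - L g], [G] is [L (L g)], [b] is the radial coefficient of the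
    gradient and [P] its squared length. Each term is [O(q)] because [|b| <= 4 B |q|]. The term in
    [G] gives the first constant, the two other fractions and [b] give [8 B + 8 B + 4 B], and the
    root gives the last one. *)
Lemma operator_estimate (n s q G K a B m c0 b P : R) :
  0 < n -> 0 < a -> a <= s -> `|G| <= K -> n ^+ 2 <= B ->
  `|n ^+ 2 - m| <= B -> `|q| <= 1 -> 0 <= c0 ->
  b = 4 * q * (n ^+ 2 - m) -> P = s ^+ 2 / n ^+ 2 + b ^+ 2 * n ^+ 2 ->
  `|(G * b ^+ 2 + 2 * s ^+ 2 * b / n ^+ 2 + 8 * q * s ^+ 2) / P + b
     + c0 * n * Num.sqrt P - c0 * s|
  <= (16 * K * B ^+ 3 / a ^+ 2 + 20 * B + 4 * c0 * B ^+ 2) * `|q|.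
Proof.
move=> n0 a0 as_ GK nB mB q1 c00 bqE PE.
have s0 : 0 < s by lra.
have N0 : 0 < n ^+ 2 by rewrite exprn_gt0.
have s20 : 0 < s ^+ 2 by rewrite exprn_gt0.
have a20 : 0 < a ^+ 2 by rewrite exprn_gt0.
have nn : n != 0 by rewrite gt_eqF.
have as2 : a ^+ 2 <= s ^+ 2 by rewrite lerXn2r// nnegrE; lra.
have q0 := normr_ge0 q.
have B0 : 0 < B by lra.
have K0 : 0 <= K by apply: le_trans GK.
have sn0 : 0 < s ^+ 2 / n ^+ 2 by rewrite divr_gt0.
have bn0 : 0 <= b ^+ 2 * n ^+ 2 by rewrite mulr_ge0 ?sqr_ge0.
have P0 : 0 < P by rewrite PE; lra.
have bE : `|b| <= 4 * B * `|q|.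
  rewrite bqE !normrM (ger0_norm (_ : 0 <= 4))//.
  by have := ler_wpM2l q0 mB; lra.
(* The assumption [|q| <= 1] enters here, to absorb [q^2] into [|q|]. *)
have b2E : b ^+ 2 <= 16 * B ^+ 2 * `|q|.
  rewrite -(real_normK (num_real b)).
  apply: (@le_trans _ _ ((4 * B * `|q|) ^+ 2)).
    by rewrite lerXn2r// nnegrE// !mulr_ge0// ltW.
  have -> : (4 * B * `|q|) ^+ 2 = 16 * B ^+ 2 * (`|q| * `|q|) by ring.
  by apply: ler_wpM2l; [rewrite mulr_ge0 ?sqr_ge0|rewrite ler_piMr].
have T1 : `|G * b ^+ 2 / P| <= 16 * K * B ^+ 3 / a ^+ 2 * `|q|.
  rewrite normrM [`|G * _|]normrM (ger0_norm (sqr_ge0 b)) (gtr0_norm (_ : 0 < P^-1)) ?invr_gt0//.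
  (* The tangential part alone bounds [P] from below: [P >= s^2 / n^2 >= a^2 / B]. *)
  have Pi : P^-1 <= B / a ^+ 2.
    rewrite invf_ple ?posrE ?divr_gt0// invf_div.
    apply: (@le_trans _ _ (s ^+ 2 / n ^+ 2)); last by rewrite PE; lra.
    by apply: ler_pM => //; [exact: ltW|rewrite invr_ge0 ltW|rewrite lef_pV2].
  apply: (@le_trans _ _ (K * (16 * B ^+ 2 * `|q|) * (B / a ^+ 2))).
    apply: ler_pM => //; first by rewrite mulr_ge0 ?sqr_ge0.
      by rewrite invr_ge0 ltW.
    by apply: ler_pM => //; rewrite sqr_ge0.
  by rewrite le_eqVlt; apply/orP; left; apply/eqP; field; rewrite gt_eqF.
have T2 : `|2 * s ^+ 2 * b / n ^+ 2 / P| <= 8 * B * `|q|.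
  have -> : 2 * s ^+ 2 * b / n ^+ 2 / P = 2 * b * (s ^+ 2 / n ^+ 2 / P).
    by field; rewrite gt_eqF.
  rewrite !normrM (ger0_norm (_ : 0 <= 2))//.
  have rP : 0 <= s ^+ 2 / n ^+ 2 / P <= 1.
    apply/andP; split; first by apply: divr_ge0; exact: ltW.
    by rewrite ler_pdivrMr// mul1r PE; lra.
  case/andP: rP => r0 r1; rewrite -!normrM (ger0_norm r0).
  have : `|b| * (s ^+ 2 / n ^+ 2 / P) <= `|b| by rewrite ler_piMr.
  rewrite -mulrA; lra.
have T3 : `|8 * q * s ^+ 2 / P| <= 8 * B * `|q|.
  have sP0 : 0 <= s ^+ 2 / P by apply: divr_ge0; exact: ltW.
  have -> : 8 * q * s ^+ 2 / P = 8 * (s ^+ 2 / P) * q by ring.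
  rewrite normrM (ger0_norm (mulr_ge0 (ler0n R 8) sP0)).
  have sP : s ^+ 2 / P <= B.
    rewrite ler_pdivrMr//; apply: (@le_trans _ _ (B * (s ^+ 2 / n ^+ 2))).
      rewrite mulrCA; apply: ler_peMr; first exact: ltW.
      by rewrite ler_pdivlMr// mul1r.
    by rewrite ler_pM2l// PE; lra.
  by have := ler_wpM2r q0 sP; lra.
have /andP[S1 S2] := sqrt_sumsq_bounds s b n n0 (ltW s0).
rewrite -PE in S1 S2.
have T4 : `|c0 * n * Num.sqrt P - c0 * s| <= 4 * c0 * B ^+ 2 * `|q|.
  have -> : c0 * n * Num.sqrt P - c0 * s = c0 * (n * Num.sqrt P - s) by ring.
  rewrite normrM (ger0_norm c00) ger0_norm ?subr_ge0//.
  have -> : 4 * c0 * B ^+ 2 * `|q| = c0 * (4 * B * `|q| * B) by ring.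
  rewrite ler_wpM2l//; apply: (@le_trans _ _ (`|b| * n ^+ 2)); first lra.
  by apply: ler_pM => //; rewrite ltW.
have -> : (G * b ^+ 2 + 2 * s ^+ 2 * b / n ^+ 2 + 8 * q * s ^+ 2) / P + b
     + c0 * n * Num.sqrt P - c0 * s = G * b ^+ 2 / P + 2 * s ^+ 2 * b / n ^+ 2 / P
     + 8 * q * s ^+ 2 / P + b + (c0 * n * Num.sqrt P - c0 * s) by ring.
move: T1 T2 T3 T4.
set t1 := G * b ^+ 2 / P; set t2 := _ / P; set t3 := _ / P; set t4 := _ - _.
move=> T1 T2 T3 T4.
have := ler_normD (t1 + t2 + t3 + b) t4; have := ler_normD (t1 + t2 + t3) b.
have := ler_normD (t1 + t2) t3; have := ler_normD t1 t2.
lra.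
Qed.

End OperatorEstimate.

Section OperatorAtTest.
Context {R : realType} (c0 : R) (g : 'cV[R]_2 -> R) (hg : C2_on setT g).
Context (A k t1 q m : R).
Implicit Types (z : 'cV[R]_2 * R).
Local Notation phi := (test_fun c0 g A k t1 q m).
Local Notation slope z := (1 - angular g (phase c0 z)).

(** The gradient splits along the orthogonal directions [x^perp] and [x]: the profile and [theta]
    give the tangential part, the wall the radial one. Its length and its product with [x]
    follow. *)
Lemma gradient_testE z : z.1 != 0 ->
  space_grad phi z - Dtheta z.1 =
  - slope z *: Dtheta z.1 + (4 * q * (enorm z.1 ^+ 2 - m)) *: z.1.
Proof.
move=> z0; apply/matrixP => i j; rewrite (ord1 j).
rewrite !mxE -/(space_grad _ _).
have := space_grad_test c0 g hg A k t1 q m z i z0.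
by rewrite !mxE => ->; ring.
Qed.

Lemma sqr_enorm_gradient_test z : z.1 != 0 ->
  enorm (space_grad phi z - Dtheta z.1) ^+ 2 =
  slope z ^+ 2 / enorm z.1 ^+ 2
  + (4 * q * (enorm z.1 ^+ 2 - m)) ^+ 2 * enorm z.1 ^+ 2.
Proof.
move=> z0; have n0 : enorm z.1 != 0 by rewrite enorm_eq0.
rewrite gradient_testE// sqr_enorm DthetaE !mxE/=.
have x0E : z.1 0 0 ^+ 2 = enorm z.1 ^+ 2 - z.1 1 0 ^+ 2.
  by rewrite sqr_enorm addrK.
move: (z.1 0 0) (z.1 1 0) (enorm _) x0E n0 => x0 x1 n x0E n0.
by field: x0E.
Qed.

Lemma dot_gradient_test z : z.1 != 0 ->
  dot (space_grad phi z - Dtheta z.1) z.1 =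
  4 * q * (enorm z.1 ^+ 2 - m) * enorm z.1 ^+ 2.
Proof.
move=> z0; have n0 : enorm z.1 != 0 by rewrite enorm_eq0.
rewrite gradient_testE// dotE DthetaE !mxE/=.
have x0E : z.1 0 0 ^+ 2 = enorm z.1 ^+ 2 - z.1 1 0 ^+ 2.
  by rewrite sqr_enorm addrK.
move: (z.1 0 0) (z.1 1 0) (enorm _) x0E n0 => x0 x1 n x0E n0.
by field: x0E.
Qed.

(** In the plane [tr ((I - p p^T / |p|^2) X)] is [X] evaluated twice on [p^perp], divided by
    [|p|^2]. For [p = - s Dtheta + b x], the products of [p^perp] with [Dtheta] and [x] are [b] and
    [s], which yields the three terms over [P]; the multiple [b] of the identity gives the term
    [b]. *)
Lemma levelset_op_test z : z.1 != 0 -> 0 < slope z ->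
  let b := 4 * q * (enorm z.1 ^+ 2 - m) in
  let P := slope z ^+ 2 / enorm z.1 ^+ 2 + b ^+ 2 * enorm z.1 ^+ 2 in
  levelset_op (fun x => c0 * enorm x) (op_arg (@Dtheta R) phi z) =
  (angular (angular g) (phase c0 z) * b ^+ 2
     + 2 * slope z ^+ 2 * b / enorm z.1 ^+ 2 + 8 * q * slope z ^+ 2) / P + b
  + c0 * enorm z.1 * Num.sqrt P.
Proof.
move=> z0 s0 b P; have n0 : enorm z.1 != 0 by rewrite enorm_eq0.
have PE : enorm (space_grad phi z - Dtheta z.1) ^+ 2 = P.
  exact: sqr_enorm_gradient_test.
rewrite /op_arg levelset_opE PE.
have -> : enorm (space_grad phi z - Dtheta z.1) = Num.sqrt P.
  by rewrite -PE sqrtr_sqr ger0_norm// enorm_ge0.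
congr (_ + _); rewrite gradient_testE// -/b.
have ng : 0 < enorm z.1 by rewrite enorm_gt0.
have P0 : P != 0.
  rewrite gt_eqF// ltr_pwDl ?divr_gt0 ?exprn_gt0// mulr_ge0 ?sqr_ge0//.
have X i j : (space_hessian phi z - Defs.jacobian (@Dtheta R) z.1) i j =
    angular (angular g) (phase c0 z) * (Dtheta z.1 i 0 * Dtheta z.1 j 0)
  + - slope z * Defs.jacobian (@Dtheta R) z.1 i j
  + b * (i == j)%:R + 8 * q * (z.1 i 0 * z.1 j 0).
  rewrite !mxE -/(space_hessian _ _).
  have := space_hessian_test c0 g hg A k t1 q m z i j z0.
  by rewrite !mxE => ->; rewrite /b; ring.
rewrite !X !jacobian_Dtheta// DthetaE /perp !vec2_0 !vec2_1 !mxE/=.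
move: P0; rewrite /P {PE X P}; move: (angular (angular g) _) b (slope z) => G b s.
have x0E : z.1 0 0 ^+ 2 = enorm z.1 ^+ 2 - z.1 1 0 ^+ 2.
  by rewrite sqr_enorm addrK.
move: (z.1 0 0) (z.1 1 0) (enorm _) x0E n0 => x0 x1 n x0E n0 P0.
(* This is [P != 0] with denominators cleared, the form of the side condition left by [field]. *)
have P1 : s ^+ 2 + (b * n * n) ^+ 2 != 0.
  apply: contra_neq P0 => E.
  have -> : s ^+ 2 / n ^+ 2 + b ^+ 2 * n ^+ 2 =
    (s ^+ 2 + (b * n * n) ^+ 2) / n ^+ 2 by field.
  by rewrite E mul0r.
by field: x0E; rewrite n0.
Qed.

End OperatorAtTest.

(** * Pointwise bound on the gradient, and compactness in the plane *)

Section GradientBound.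
Context {R : realType}.
Implicit Types (x y : 'cV[R]_2) (g : 'cV[R]_2 -> R).

Lemma product_lebesgue_box_gt0 (a b e : R) : 0 < e ->
  (0 < (lebesgue_measure \x lebesgue_measure)
         (`](a - e)%R, (a + e)%R[%classic `*` `](b - e)%R, (b + e)%R[%classic))%E.
Proof.
move=> e0; rewrite product_measure1E; [|exact: measurable_itv..].
have mI (c : R) : (0 < lebesgue_measure (`](c - e)%R, (c + e)%R[%classic : set R))%E.
  by rewrite lebesgue_measure_itv/= lte_fin ifT; [rewrite -EFinB lte_fin|]; lra.
by apply: mule_gt0; exact: mI.
Qed.

(** As [Dg] is continuous, an almost everywhere bound holds everywhere: a point where it fails has a
    whole box around it where it fails, and boxes have positive measure. The strict inequality
    leaves room for a uniform [M < 1]. *)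
Lemma grad_Linfty_bound g : C1_on setT g -> (grad_Linfty g < 1)%E ->
  exists2 M, M < 1 & forall x, enorm (grad g x) <= M.
Proof.
move=> Cg; rewrite /grad_Linfty unlock.
set mu := (lebesgue_measure \x lebesgue_measure)%E.
(* The norm with exponent [+oo] is defined by cases on whether the whole space has positive
   measure. *)
have muT : (0 < mu setT)%E.
  apply: lt_le_trans (product_lebesgue_box_gt0 0 0 1 ltr01) _.
  apply: le_measure => //; rewrite inE; last exact: measurableT.
  by apply: measurableX; exact: measurable_itv.
rewrite muT => sup1.
have [r r1 supr] : exists2 r : R, r < 1 &
   {ae mu, forall z, enorm (grad g (vec2 z.1 z.2)) <= r}.
  have [y ae_y y1] := ereal_inf_lt sup1.
  (* The essential bound [y] is an extended real; should it be [-oo], the bound 0 replaces it. *)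
  have ae_pos : exists2 r : R, r < 1 & (y <= r%:E)%E.
    case: y y1 {ae_y} => [s||] //.
      by rewrite lte_fin => s1; exists s.
    by move=> _; exists 0 => //; rewrite leNye.
  case: ae_pos => r r1 yr; exists r => //.
  apply: filterS ae_y => z /= zy; rewrite -lee_fin.
  apply: le_trans yr; apply: le_trans zy; exact: lee_abs.
exists r => // x; rewrite leNgt; apply/negP => rx.
case: supr => N [mN N0 subN].
have cgrad : {for x, continuous (fun y => enorm (grad g y))}.
  apply: (@continuous_comp _ _ _ (grad g) (@enorm R)); last exact: enorm_continuous.
  have -> : grad g = fun y => vec2 ('D_(basis2 R 0) g y) ('D_(basis2 R 1) g y).
    by apply/funext => y; apply: plane_eqP; rewrite !mxE.
  by apply: (@cvg_vec2 _ _ (nbhs x)); [exact: (Cg.2 (basis2 R 0) x I)|exact: (Cg.2 (basis2 R 1) x I)].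
have cbox : {for (x 0 0, x 1 0), continuous
    (fun z : R * R => enorm (grad g (vec2 z.1 z.2)))}.
  apply: (@continuous_comp _ _ _ (fun z : R * R => vec2 z.1 z.2)
    (fun y => enorm (grad g y))); last by rewrite /= vec2_eta.
  by apply: cvg_vec2; [exact: cvg_fst|exact: cvg_snd].
have : \forall z \near (x 0 0, x 1 0), r < enorm (grad g (vec2 z.1 z.2)).
  by apply: (cvgr_gt _ cbox); rewrite /= vec2_eta.
move=> /nbhs_ballP[e /= e0 eball].
have := product_lebesgue_box_gt0 (x 0 0) (x 1 0) e e0.
apply/negP; rewrite -leNgt -N0.
apply: le_measure => //; rewrite ?inE//.
  by apply: measurableX; exact: measurable_itv.
move=> [a b] [/=]; rewrite !in_itv/= => /andP[a1 a2] /andP[b1 b2].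
apply: subN => /=; apply/negP; rewrite -ltNge; apply: (eball (a, b)).
by split; rewrite /ball/= ltr_norml; apply/andP; split; lra.
Qed.

(** This is the Cauchy-Schwarz inequality for [x^perp] and [Dg], by way of Lagrange's identity. *)
Lemma angular_le g x : enorm x = 1 -> angular g x <= enorm (grad g x).
Proof.
move=> x1; apply: le_trans (ler_norm _) _.
rewrite -(ler_pXn2r (n := 2))// ?nnegrE ?enorm_ge0// sqr_enorm.
rewrite real_normK ?num_real// /angular !mxE.
have := sqr_enorm x; rewrite x1 expr1n.
move: (x 0 0) (x 1 0) ('D_(basis2 R 0) g x) ('D_(basis2 R 1) g x) => a b c d ab.
have -> : c ^+ 2 + d ^+ 2 = (- b * c + a * d) ^+ 2 + (a * c + b * d) ^+ 2.
  transitivity ((a ^+ 2 + b ^+ 2) * (c ^+ 2 + d ^+ 2)); last by ring.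
  by rewrite -ab mul1r.
by rewrite lerDl sqr_ge0.
Qed.

(** A closed bounded set is a closed subset of the image of a compact square under [vec2]. *)
Lemma compact_plane (K : set 'cV[R]_2) B : closed K ->
  (forall x, K x -> enorm x <= B) -> compact K.
Proof.
move=> cK KB.
have cV : continuous (fun z : R * R => vec2 z.1 z.2).
  by move=> z; apply: cvg_vec2; [exact: cvg_fst|exact: cvg_snd].
have cI : compact ((fun z : R * R => vec2 z.1 z.2) @`
    (`[- B, B]%classic `*` `[- B, B]%classic)).
  apply: continuous_compact; first exact: continuous_subspaceT.
  by apply: compact_setX; exact: segment_compact.
apply: subclosed_compact cK cI _ => x Kx.
have coordB i : `|x i 0| <= B.
  apply: le_trans (KB x Kx).
  rewrite -(ler_pXn2r (n := 2))// ?nnegrE ?enorm_ge0// sqr_enorm.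
  rewrite real_normK ?num_real//.
  by have [->|->] := ord2P i; rewrite ?lerDl ?lerDr sqr_ge0.
exists (x 0 0, x 1 0); last by rewrite /= vec2_eta.
by split=> /=; rewrite in_itv/= -ler_norml.
Qed.

(** The phase lies on the unit circle, so a bound there on [L (L g)] suffices, even if [D^2 g] is
    unbounded on the plane. *)
Lemma continuous_bounded_circle (f : 'cV[R]_2 -> R) : continuous f ->
  exists K, forall x, enorm x = 1 -> `|f x| <= K.
Proof.
move=> cf.
have cS : compact [set x : 'cV[R]_2 | enorm x = 1].
  apply: (compact_plane _ 1); last by move=> x /= ->.
  have -> : [set x : 'cV[R]_2 | enorm x = 1] = @enorm R @^-1` [set 1] by [].
  apply: closed_comp; last exact: closed_eq.
  by move=> x _; exact: enorm_continuous.
have e1 : enorm (basis2 R 0) = 1.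
  apply/eqP; rewrite -(@eqrXn2 _ 2) ?enorm_ge0// expr1n sqr_enorm !mxE/=.
  by rewrite expr1n expr0n addr0.
have [c _ cM] := @compact_EVT_max _ R (fun x => `|f x|) _
  (ex_intro _ _ e1) cS (continuous_subspaceT (fun x => continuous_comp (cf x)
    (@norm_continuous _ R^o (f x)))).
by exists `|f c| => x x1; apply: cM; rewrite inE.
Qed.

End GradientBound.

(** * Comparison *)

Section Contact.
Context {R : realType}.
Implicit Types (W : set 'cV[R]_2) (D h : 'cV[R]_2 * R -> R).

(* The exponential barrier is small at time [t1] and exceeds the bound of [D] at time
   [t1 + 1]; this keeps the maximum away from the final time without any growth
   condition on [D]. *)
Lemma contact_point W D h x1 t1 : compact (closure W) ->
  {within closed_cylinder W, continuous D} -> continuous h ->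
  (forall z, 0 <= h z) -> (forall x, closure W x -> D (x, 0) <= 0) ->
  closure W x1 -> 0 <= t1 -> 0 < D (x1, t1) ->
  exists A k d0, [/\ 0 < A, 0 < k, 0 < d0 &
    forall d, 0 < d -> d <= d0 -> exists2 z0, cylinder W z0 &
      \forall z \near z0, cylinder W z ->
        D z - (A * expR (k * (z.2 - t1)) + d * h z) <=
        D z0 - (A * expR (k * (z0.2 - t1)) + d * h z0)].
Proof.
move=> cW cD ch h0 D0 Wx1 t10 Dpos.
set K : set ('cV[R]_2 * R) := closure W `*` `[0, t1 + 1]%classic.
have cK : compact K by apply: compact_setX => //; exact: segment_compact.
have Kx1 : K (x1, t1) by split=> //=; rewrite in_itv/= t10/=; lra.
have K0 : K !=set0 by exists (x1, t1).
have KD : {within K, continuous D}.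
  apply: continuous_subspaceW cD => -[x t] [/= Wx].
  by rewrite in_itv/= => /andP[].
have [zD _ maxD] := compact_EVT_max K0 cK KD.
have [zh _ maxh] := compact_EVT_max K0 cK (continuous_subspaceT ch).
set mu := D (x1, t1) in Dpos *.
set M := D zD; set H := h zh.
have muM : mu <= M by apply: maxD; rewrite inE.
have H0 : 0 <= H by exact: h0.
(* With [mu / 4 * k = M], the inequality [expR k >= 1 + k] makes the exponential term at least
   [mu / 4 + M] at time [t1 + 1]. *)
set k := 4 * M / mu.
have k0 : 0 < k by rewrite divr_gt0// mulr_gt0//; lra.
have muk : mu / 4 * k = M by rewrite /k; field; rewrite gt_eqF.
exists (mu / 4), k, (mu / (4 * (H + 1))); split=> //; first lra.
  by rewrite divr_gt0// mulr_gt0//; lra.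
move=> d d_gt0 dle.
have dH z : K z -> d * h z <= mu / 4.
  move=> Kz; apply: (@le_trans _ _ (d * (H + 1))).
    rewrite ler_pM2l//; have := maxh z; rewrite inE => /(_ Kz); rewrite -/H; lra.
  move: dle; rewrite invfM mulrA ler_pdivlMr//; lra.
set F := fun z : 'cV[R]_2 * R => D z - (mu / 4 * expR (k * (z.2 - t1)) + d * h z).
have KF : {within K, continuous F}.
  have cB : continuous (fun z : 'cV[R]_2 * R =>
      mu / 4 * expR (k * (z.2 - t1)) + d * h z).
    move=> z; apply: (@continuousD _ _ _
      (fun z : 'cV[R]_2 * R => mu / 4 * expR (k * (z.2 - t1))) (fun z => d * h z)).
      apply: differentiable_continuous.
      by have [] := has_deriv_exp_time (mu / 4) k t1 z.
    by apply: continuousM; [exact: cvg_cst|exact: ch].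
  move=> z; apply: cvgB; first exact: KD.
  exact: (continuous_subspaceT cB).
have [z0] := compact_EVT_max K0 cK KF; rewrite inE => Kz0 maxF.
have [clz0] := Kz0; rewrite /= in_itv/= => /andP[t0 tT].
(* At [(x1, t1)] the exponential term and [d * h] cost at most [mu / 4] each. The maximum is thus
   positive, which rules out time 0, where [D <= 0], and the final time. *)
have Fz0 : mu / 2 <= F z0.
  have := maxF (x1, t1); rewrite inE => /(_ Kx1); apply: le_trans.
  by have := dH _ Kx1; rewrite /F /= subrr mulr0 expR0 mulr1 -/mu; lra.
have dh0 : 0 <= d * h z0 by rewrite mulr_ge0// ltW.
have tpos : 0 < z0.2.
  rewrite lt_neqAle t0 andbT; apply/eqP => t0E.
  have := D0 z0.1 clz0; rewrite t0E -surjective_pairing => Dz0.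
  have : 0 < mu / 4 * expR (k * (z0.2 - t1)) by rewrite mulr_gt0 ?expR_gt0//; lra.
  by move: Fz0; rewrite /F; lra.
have tlt : z0.2 < t1 + 1.
  rewrite lt_neqAle tT andbT; apply/eqP => tE.
  have DM : D z0 <= M by apply: maxD; rewrite inE.
  have eM : mu / 4 + M <= mu / 4 * expR (k * (z0.2 - t1)).
    rewrite -muk -{1}[mu / 4]mulr1 -mulrDr ler_pM2l ?divr_gt0// tE.
    have -> : k * (t1 + 1 - t1) = k by ring.
    exact: expR_ge1Dx.
  by move: Fz0 eM; rewrite /F; lra.
exists z0; first by split.
(* Since [z0] lies strictly before the final time, the maximum over [K] is a local maximum over the
   unbounded cylinder. *)
have : \forall z \near z0, z.2 < t1 + 1.
  apply: (@cvgr_lt _ _ (nbhs z0) _ snd z0.2) => //; exact: cvg_snd.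
apply: filterS => z zT [clz z2]; apply: (maxF z); rewrite inE; split=> //=.
by rewrite in_itv/= !ltW.
Qed.
End Contact.

(** * Closure and boundary of the annulus *)

Section Annulus.
Context {R : realType} (r1 r2 : R) (hr1 : 0 < r1) (hr12 : r1 < r2).
Implicit Types (x : 'cV[R]_2).

Lemma closure_annulus x : closure (annulus r1 r2) x -> r1 <= enorm x <= r2.
Proof.
have cl : closed [set x : 'cV[R]_2 | r1 <= enorm x <= r2].
  have -> : [set x : 'cV[R]_2 | r1 <= enorm x <= r2] =
      @enorm R @^-1` [set` `[r1, r2]] by apply/seteqP; split=> y /=; rewrite in_itv.
  apply: closed_comp; last exact: interval_closed.
  by move=> y _; exact: enorm_continuous.
move=> clx; apply: cl; apply: closure_subset clx => y /= /andP[a b].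
by rewrite !ltW.
Qed.

Lemma compact_closure_annulus : compact (closure (annulus r1 r2)).
Proof.
apply: (compact_plane _ r2); first exact: closed_closure.
by move=> x /closure_annulus /andP[].
Qed.

Lemma closure_annulus_neq0 x : closure (annulus r1 r2) x -> x != 0.
Proof.
by move=> /closure_annulus /andP[+ _]; rewrite -enorm_gt0; exact: lt_le_trans.
Qed.

Lemma boundary_annulus x : closure (annulus r1 r2) x -> ~ annulus r1 r2 x ->
  boundary (annulus r1 r2) x /\ (enorm x = r1 \/ enorm x = r2).
Proof.
move=> clx nx; split; first by split=> // /interior_subset.
have /andP[a b] := closure_annulus x clx.
have [->|n1] := eqVneq (enorm x) r1; first by left.
have [->|n2] := eqVneq (enorm x) r2; first by right.
by exfalso; apply: nx; rewrite /annulus/= !lt_neqAle a b n2 eq_sym n1.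
Qed.

End Annulus.

Section Comparison.
Context {R : realType} (r1 r2 c0 : R) (g : 'cV[R]_2 -> R) (hg : C2_on setT g)
  (hDg : (grad_Linfty g < 1)%E).
Local Notation W := (annulus r1 r2).
Local Notation m := ((r1 ^+ 2 + r2 ^+ 2) / 2).
Implicit Types (z : 'cV[R]_2 * R) (u : 'cV[R]_2 * R -> R).

(** The tangential part is orthogonal to the normal. Since [m] is the mean of the squared radii,
    [|x|^2 - m] changes sign between the two circles, just as the normal does relative to [x]; the
    result has the sign of [q] on both. *)
Lemma dot_gradient_test_normal (hr1 : 0 < r1) (hr12 : r1 < r2) A k t1 q z :
  closure W z.1 -> ~ W z.1 ->
  exists2 a, 0 < a &
    dot (space_grad (test_fun c0 g A k t1 q m) z - Dtheta z.1)
      (annulus_normal r1 r2 z.1) = q * a.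
Proof.
move=> clz nz; have z0 := closure_annulus_neq0 _ _ hr1 _ clz.
have G := dot_gradient_test c0 g hg A k t1 q m z z0.
have dotZ (p x : 'cV[R]_2) (b : R) : dot p (b *: x) = b * dot p x.
  by rewrite !dotE !mxE; ring.
have dotN (p x : 'cV[R]_2) : dot p (- x) = - dot p x.
  by rewrite !dotE !mxE; ring.
have r12 : r1 ^+ 2 < r2 ^+ 2 by rewrite ltrXn2r// ?nnegrE ltW// (lt_trans hr1).
rewrite /annulus_normal.
have [_ [n1|n2]] := boundary_annulus _ _ _ clz nz.
  rewrite n1 lt_eqF// dotN dotZ G n1.
  exists (2 * r1 * (r2 ^+ 2 - r1 ^+ 2)); first by rewrite !mulr_gt0// subr_gt0.
  by field; rewrite gt_eqF.
have r20 : 0 < r2 := lt_trans hr1 hr12.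
rewrite n2 eqxx dotZ G n2.
exists (2 * r2 * (r2 ^+ 2 - r1 ^+ 2)); first by rewrite !mulr_gt0// subr_gt0.
by field; rewrite gt_eqF.
Qed.

(** The estimate is applied with [a = 1 - M] and [B = r2^2], which bounds both [|x|^2] and its
    distance to [m]. The constant does not depend on [A], [k], [t1] or [q], so [q] can be chosen
    last. *)
Lemma levelset_op_test_estimate (hr1 : 0 < r1) (hr12 : r1 < r2) (hc0 : 0 < c0) :
  exists2 C, 0 <= C &
  forall A k t1 q z, closure W z.1 -> `|q| <= 1 ->
    space_grad (test_fun c0 g A k t1 q m) z - Dtheta z.1 != 0 /\
    `|levelset_op (fun x => c0 * enorm x)
        (op_arg (@Dtheta R) (test_fun c0 g A k t1 q m) z)
      - c0 * (1 - angular g (phase c0 z))| <= C * `|q|.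
Proof.
have [M M1 gM] := grad_Linfty_bound g hg.1 hDg.
have [K GK] := continuous_bounded_circle (angular (angular g))
  (angular_continuous _ (C1_angular _ hg)).
have r20 : 0 < r2 := lt_trans hr1 hr12.
have a0 : 0 < 1 - M by lra.
have K0 : 0 <= K.
  have e1 : enorm (basis2 R 0) = 1.
    apply/eqP; rewrite -(@eqrXn2 _ 2) ?enorm_ge0// expr1n sqr_enorm !mxE/=.
    by rewrite expr1n expr0n addr0.
  exact: le_trans (normr_ge0 _) (GK _ e1).
exists (16 * K * (r2 ^+ 2) ^+ 3 / (1 - M) ^+ 2 + 20 * r2 ^+ 2
    + 4 * c0 * (r2 ^+ 2) ^+ 2).
  have h1 : 0 <= 16 * K * (r2 ^+ 2) ^+ 3 / (1 - M) ^+ 2.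
    apply: divr_ge0; last exact: sqr_ge0.
    by apply: mulr_ge0; [exact: mulr_ge0|apply: exprn_ge0; exact: sqr_ge0].
  have h2 : 0 <= 4 * c0 * (r2 ^+ 2) ^+ 2 by rewrite !mulr_ge0 ?sqr_ge0// ltW.
  have h3 : 0 <= r2 ^+ 2 by rewrite sqr_ge0.
  lra.
move=> A k t1 q z clz q1.
have z0 := closure_annulus_neq0 _ _ hr1 _ clz.
have ng : 0 < enorm z.1 by rewrite enorm_gt0.
have ph := enorm_phase c0 z z0.
have aM := le_trans (angular_le g _ ph) (gM (phase c0 z)).
have s0 : 0 < 1 - angular g (phase c0 z) by lra.
have /andP[n1 n2] := closure_annulus _ _ _ clz.
have N1 : r1 ^+ 2 <= enorm z.1 ^+ 2 by rewrite lerXn2r// nnegrE; lra.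
have N2 : enorm z.1 ^+ 2 <= r2 ^+ 2 by rewrite lerXn2r// nnegrE; lra.
have r1sq : 0 < r1 ^+ 2 by rewrite exprn_gt0.
split.
  rewrite -enorm_eq0 -sqrf_eq0 sqr_enorm_gradient_test// gt_eqF//.
  by apply: ltr_pwDl; [rewrite divr_gt0 ?exprn_gt0|rewrite mulr_ge0 ?sqr_ge0].
rewrite levelset_op_test//.
apply: operator_estimate => //; [lra|exact: GK| |lra].
by rewrite ler_norml; apply/andP; split; lra.
Qed.

Lemma profile_continuous z : z.1 != 0 -> {for z, continuous (profile c0 g)}.
Proof.
move=> z0; apply: differentiable_continuous; apply: differentiableD.
  by have [] := has_deriv_comp_phase c0 g z z0 (hg.1.1 _ I).
by have [] := has_derivM (has_deriv_cst c0 z) (has_deriv_time z).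
Qed.

(** The case [s = 1] gives [u <= v] from the subsolution property, and [s = -1] gives [v <= u] from
    the supersolution property. *)
Lemma viscosity_comparison (hr1 : 0 < r1) (hr12 : r1 < r2) (hc0 : 0 < c0)
    (u0 : 'cV[R]_2 -> R) u (s : R) :
  s = 1 \/ s = -1 ->
  (forall x, closure W x -> u0 x = g ((enorm x)^-1 *: x)) ->
  visc_solution W (annulus_normal r1 r2) (fun x => c0 * enorm x) (@Dtheta R) u0 u ->
  forall x t, closure W x -> 0 <= t ->
  s * (u (x, t) - profile c0 g (x, t)) <= 0.
Proof.
move=> hs hu0 [cu sub super ini] x1 t1 clx1 t10; rewrite leNgt; apply/negP => Dpos.
set D := fun z => s * (u z - profile c0 g z).
set h := fun z : 'cV[R]_2 * R => (enorm z.1 ^+ 2 - m) ^+ 2.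
have cD : {within closed_cylinder W, continuous D}.
  have cp : {within closed_cylinder W, continuous (profile c0 g)}.
    apply: continuous_in_subspaceT => z; rewrite inE => -[clz _].
    by apply: profile_continuous; exact: closure_annulus_neq0 clz.
  move=> z; apply: cvgM; first exact: cvg_cst.
  by apply: cvgB; [exact: cu|exact: cp].
have ch : continuous h.
  move=> z; apply: differentiable_continuous.
  have [+ _] := has_deriv_wall 1 m z.
  by under eq_fun do rewrite mul1r.
have D0 x : closure W x -> D (x, 0) <= 0.
  move=> clx; rewrite /D ini// hu0// /profile /phase /= mulr0 oppr0.
  rewrite rotationE cos0 sin0 !mul1r !mul0r subr0 add0r vec2_eta addr0 subrr.
  by rewrite mulr0.
have [A [k [d0 [A0 k0 d00 contact]]]] := contact_point W D h x1 t1
  (compact_closure_annulus r1 r2) cD ch (fun z => sqr_ge0 _) D0 clx1 t10 Dpos.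
have [C C0 estimate] := levelset_op_test_estimate hr1 hr12 hc0.
(* This is the time derivative of the exponential at time 0, a lower bound at every later time and
   so at any contact point. *)
set eta := k * A * expR (- (k * t1)).
have eta0 : 0 < eta by rewrite !mulr_gt0// expR_gt0.
(* The three bounds serve contact, the condition [|q| <= 1], and [C * d < eta]; [C + 1] avoids
   dividing by a vanishing [C]. *)
set d := Num.min d0 (Num.min 1 (eta / (C + 1) / 2)).
have C10 : 0 < C + 1 by lra.
have d_gt0 : 0 < d.
  by rewrite !lt_min d00 ltr01 !divr_gt0.
have dd0 : d <= d0 by rewrite ge_min lexx.
have d1 : d <= 1 by rewrite !ge_min lexx orbT.
have deta : C * d < eta.
  have : d <= eta / (C + 1) / 2 by rewrite !ge_min lexx !orbT.
  have : C * d <= (C + 1) * d by rewrite ler_pM2r//; lra.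
  rewrite -[d <= _](ler_pM2l C10).
  have -> : (C + 1) * (eta / (C + 1) / 2) = eta / 2 by field; rewrite gt_eqF.
  lra.
have [z0 cyl0 max0] := contact d d_gt0 dd0.
have [clz0 t0] := cyl0.
have z00 := closure_annulus_neq0 _ _ hr1 _ clz0.
set phi := test_fun c0 g (s * A) k t1 (s * d) m.
have s1 : `|s| = 1 by case: hs => ->; rewrite ?normrN normr1.
have qd : `|s * d| = d by rewrite normrM s1 mul1r gtr0_norm.
have [p0 est] := estimate (s * A) k t1 (s * d) z0 clz0 (eq_ind_r (fun a => a <= 1) d1 qd).
rewrite qd -/phi in est p0.
have ctsc : continuous (fun x : 'cV[R]_2 => c0 * enorm x).
  move=> x; apply: (@continuousM _ _ (fun=> c0) (@enorm R)).
    exact: cst_continuous.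
  exact: enorm_continuous.
have tphi : time_deriv phi z0 = c0 * (1 - angular g (phase c0 z0))
    + s * (k * A * expR (k * (z0.2 - t1))).
  by rewrite /phi time_deriv_test//; ring.
have etale : eta <= k * A * expR (k * (z0.2 - t1)).
  rewrite /eta ler_pM2l ?mulr_gt0// ler_expR mulrBr.
  have : 0 < k * z0.2 by rewrite mulr_gt0.
  lra.
(* As [s^2 = 1], the maximum provided by contact is one of [s * (u - phi)]. *)
have Dphi z : D z - (A * expR (k * (z.2 - t1)) + d * h z) = s * (u z - phi z).
  rewrite /D /phi /test_fun /barrier /h.
  by case: hs => ->; ring.
have C2phi := C2_test c0 g hg (s * A) k t1 (s * d) m.
have normal := dot_gradient_test_normal hr1 hr12 (s * A) k t1 (s * d) z0 clz0.
have oU := @open_off_axis R.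
case: hs => sE.
- have lmax : \forall z \near z0, cylinder W z -> u z - phi z <= u z0 - phi z0.
    by apply: filterS max0 => z + cylz => /(_ cylz); rewrite !Dphi sE !mul1r.
  have [ineqW ineqB] := sub z0 _ phi cyl0 oU z00 C2phi lmax.
  (* The time derivative exceeds [c0 (1 - L g)] by at least [eta], the operator by at most
     [C * d < eta]. *)
  have nineq : ~ ((time_deriv phi z0)%:E <= usc_op W (fun x => (c0 * enorm x)%R)
      (op_arg (@Dtheta R) phi z0))%E.
    move=> /le_trans /(_ (usc_op_le _ _ _ _ _ ctsc p0)).
    rewrite lee_fin tphi sE; move: est; rewrite ler_norml => /andP[_ +]; lra.
  have [Wz|nWz] := pselect (W z0.1); first exact: nineq (ineqW Wz).
  have [bz _] := boundary_annulus _ _ _ clz0 nWz.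
  have [/nineq //|] := ineqB bz.
  have [a a0 ->] := normal nWz.
  by rewrite sE mul1r leNgt mulr_gt0.
- have lmin : \forall z \near z0, cylinder W z -> u z0 - phi z0 <= u z - phi z.
    by apply: filterS max0 => z + cylz => /(_ cylz); rewrite !Dphi sE; lra.
  have [ineqW ineqB] := super z0 _ phi cyl0 oU z00 C2phi lmin.
  have nineq : ~ (lsc_op W (fun x => (c0 * enorm x)%R) (op_arg (@Dtheta R) phi z0)
      <= (time_deriv phi z0)%:E)%E.
    move=> /(le_trans (lsc_op_ge _ _ _ _ _ ctsc p0)).
    rewrite lee_fin tphi sE; move: est; rewrite ler_norml => /andP[+ _]; lra.
  have [Wz|nWz] := pselect (W z0.1); first exact: nineq (ineqW Wz).
  have [bz _] := boundary_annulus _ _ _ clz0 nWz.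
  have [/nineq //|] := ineqB bz.
  have [a a0 ->] := normal nWz.
  by rewrite sE mulN1r mulNr oppr_ge0 leNgt mulr_gt0.
Qed.

End Comparison.

(** * The orbit of the phase on the unit circle *)

Section PhaseOrbit.
Context {R : realType} (c0 : R) (hc0 : 0 < c0).

(** The angle must be nonnegative because it becomes a time: below the axis [2 pi - acos a] replaces
    [- acos a]. *)
Lemma cos_sin_surjective (a b : R) : a ^+ 2 + b ^+ 2 = 1 ->
  exists phi, [/\ 0 <= phi, cos phi = a & sin phi = b].
Proof.
move=> ab.
have a1 : -1 <= a <= 1.
  rewrite -ler_norml -(ler_pXn2r (n := 2))// ?nnegrE// expr1n.
  by rewrite real_normK ?num_real// -ab lerDl sqr_ge0.
have acosI : a \in `[-1, 1] by rewrite in_itv.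
have sinE : sin (acos a) = `|b|.
  by rewrite sin_acos// -sqrtr_sqr; congr Num.sqrt; rewrite -ab addrC addKr.
have [b0|b0] := leP 0 b.
  by exists (acos a); rewrite acos_ge0// acosK// sinE ger0_norm.
exists (- acos a + pi *+ 2); rewrite cosD2pi sinD2pi cosN sinN acosK// sinE.
by rewrite ltr0_norm// opprK; split=> //; have := acos_lepi a1; have := pi_ge0 R; lra.
Qed.

(** The phase turns clockwise at speed [c0]. The clockwise angle from [x] to [w] has the scalar
    product as cosine and minus the determinant as sine, both divided by [|x|]. *)
Lemma phase_surjective (x w : 'cV[R]_2) : x != 0 -> enorm w = 1 ->
  exists2 s, 0 <= s & phase c0 (x, s) = w.
Proof.
move=> x0 w1; have n0 : enorm x != 0 by rewrite enorm_eq0.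
have := sqr_enorm w; rewrite w1 expr1n => wE.
have xE := sqr_enorm x.
have unit : ((x 0 0 * w 0 0 + x 1 0 * w 1 0) / enorm x) ^+ 2
    + ((x 1 0 * w 0 0 - x 0 0 * w 1 0) / enorm x) ^+ 2 = 1.
  transitivity ((x 0 0 ^+ 2 + x 1 0 ^+ 2) * (w 0 0 ^+ 2 + w 1 0 ^+ 2)
    / enorm x ^+ 2); first by field.
  by rewrite -xE -wE mulr1 divff// sqrf_eq0.
have [phi [phi0 cphi sphi]] := cos_sin_surjective _ _ unit.
exists (phi / c0); first by rewrite divr_ge0// ltW.
have e : c0 * (phi / c0) = phi by rewrite mulrC divfK// gt_eqF.
have x0E : x 0 0 ^+ 2 = enorm x ^+ 2 - x 1 0 ^+ 2 by rewrite xE addrK.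
apply: plane_eqP; rewrite ?phase0 ?phase1 /= e cphi sphi;
  move: (x 0 0) (x 1 0) (enorm x) (w 0 0) (w 1 0) x0E n0 => a b n p q x0E n0;
  by field: x0E.
Qed.

Lemma phase_periodic (x : 'cV[R]_2) s n :
  phase c0 (x, s + n%:R * (pi *+ 2 / c0)) = phase c0 (x, s).
Proof.
elim: n => [|n IH]; first by rewrite mul0r addr0.
rewrite -IH.
have -> : s + n.+1%:R * (pi *+ 2 / c0) = (s + n%:R * (pi *+ 2 / c0)) + pi *+ 2 / c0.
  by rewrite -natr1; ring.
move: (s + _) => t.
have e : c0 * (t + pi *+ 2 / c0) = c0 * t + pi *+ 2.
  by rewrite mulrDr [c0 * (_ / _)]mulrC divfK// gt_eqF.
by apply: plane_eqP; rewrite ?phase0 ?phase1 /= e cosD2pi sinD2pi.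
Qed.

End PhaseOrbit.

Theorem proposition1p8 (R : realType) (r1 r2 c0 : R)
  (hr1 : 0 < r1) (hr12 : r1 < r2) (hc0 : 0 < c0)
  (g : 'cV[R]_2 -> R) (hg : C2_on setT g) (hDg : (grad_Linfty g < 1)%E)
  (u0 : 'cV[R]_2 -> R)
  (hu0 : forall x, closure (annulus r1 r2) x -> u0 x = g ((enorm x)^-1 *: x))
  (u : 'cV[R]_2 * R -> R)
  (hu : visc_solution (annulus r1 r2) (annulus_normal r1 r2)
          (fun x => c0 * enorm x) (@Dtheta R) u0 u) :
  (forall (x : 'cV[R]_2) (t : R), closure (annulus r1 r2) x -> 0 <= t ->
     u (x, t) = g (rotation (- (c0 * t)) *m ((enorm x)^-1 *: x)) + c0 * t) /\
  ((exists y z : 'cV[R]_2, [/\ enorm y = 1, enorm z = 1 & g y != g z]) ->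
   forall x : 'cV[R]_2, closure (annulus r1 r2) x ->
     ~ cvg ((fun t : R => u (x, t) - c0 * t) @ +oo)).
Proof.
have uE x t : closure (annulus r1 r2) x -> 0 <= t ->
    u (x, t) = g (phase c0 (x, t)) + c0 * t.
  move=> clx t0.
  have cmp s hs := viscosity_comparison r1 r2 c0 g hg hDg hr1 hr12 hc0 u0 u s hs
    hu0 hu x t clx t0.
  have := cmp 1 (or_introl erefl); have := cmp (-1) (or_intror erefl).
  by rewrite /profile /=; lra.
split; first exact: uE.
move=> [y [z [y1 z1 gyz]]] x clx; set f := fun t => _; move=> /cvg_ex[l fl].
have x0 := closure_annulus_neq0 r1 r2 hr1 x clx.
(* A limit [l] would force [g] to equal [l] on the whole unit circle, against the two distinct
   values. *)
suff gl w : enorm w = 1 -> g w = l by move: gyz; rewrite !gl ?eqxx.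
move=> w1; have [s s0 sw] := phase_surjective c0 hc0 x w x0 w1.
apply/eqP; rewrite eq_sym -subr_eq0 -normr_le0; apply/ler_addgt0Pr => e e0.
rewrite add0r.
move/cvgrPdist_le : fl => /(_ e e0) [M [_ fM]].
have p0 : 0 < pi *+ 2 / c0 by rewrite divr_gt0// mulrn_wgt0// pi_gt0.
set T := pi *+ 2 / c0 in p0.
(* After [N] periods the phase is again at [w], at a time past the threshold [M], so [g w] is within
   [e] of [l]. *)
have [N NM] : exists N : nat, M < N%:R * T.
  exists (Num.truncn `|M / T|).+1.
  rewrite -ltr_pdivrMr//; apply: le_lt_trans (ler_norm _) _.
  by rewrite truncnS_gt.
have := fM (s + N%:R * T); rewrite /f uE//; last first.
  by rewrite addr_ge0// mulr_ge0// ltW.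
rewrite phase_periodic// sw addrK; apply.
by apply: lt_le_trans NM _; rewrite lerDr.
Qed.
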